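(* Let $a<b$ be real numbers and let $U=(a,b)$. Let $m\ge 2$ be a real number and let $a_1,a_2$ be positive real numbers with $a_1\le a_2$. Let $\mathbf{f}\in C([0,\infty);L^2(U))$ satisfy $\mathbf{f}(t)\equiv \mathbf{f}(0)$ for all $t\in[0,\infty)$. Let $F:\mathbb{R}\to\mathbb{R}$ be a continuous function such that $F(z)z\ge 0$ for all $z\in\mathbb{R}$ and $$|a_1(z+|z|^{m-2}z)|\le |F(z)|\le |a_2(z+|z|^{m-2}z)|\quad\text{for all } z\in\mathbb{R}.$$ Let $G:\mathbb{R}\to\mathbb{R}$ be the function $G\equiv 0$. Let $u_0\in H^4_*(U)$ and $u_1\in H^2_*(U)$. If there exists a unique global pseudo classical solution $\mathbf{u}(t)$ of the initial/boundary value problem $$\begin{aligned}& u_{tt}+u_{xxxx}+F(u_t)+G(u)=f(x,t), && (x,t)\in(a,b)\times(0,\infty),\\ & u(a,t)=0=u(b,t), && t\in(0,\infty),\\ & u_{xx}(a,t)=0=u_{xx}(b,t), && t\in(0,\infty),\\ & u(x,0)=u_0(x),\quad u_t(x,0)=u_1(x), && x\in(a,b),\end{aligned}$$ where $f(x,t)=[\mathbf{f}(t)](x)$, then $\|\mathbf{u}(t)-\hat{u}\|_{H^2_*(U)}$ exhibits exponential decay and $\|\mathbf{u}'(t)\|_{L^2(U)}$ exhibits exponential decay, where $\hat{u}$ is the solution of the boundary value problem $$u_{xxxx}+G(u)=\mathbf{f}(0)\ \text{ on } (a,b),\qquad u(a)=0=u(b),\qquad u_{xx}(a)=0=u_{x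x}(b).$$
   Context: All functions are real-valued. For $U=(a,b)$ a bounded open interval, $H^k(U)$ is the usual $L^2$-based Sobolev space and $H^1_0(U)$ is the closure of $C_c^\infty(U)$ in $H^1(U)$. $H^2_*(U):=H^1_0(U)\cap H^2(U)$, equipped with the inner product $(u,v)_{H^2_*}=\int_U u_{xx}v_{xx}\,dx$, with associated norm $\|\cdot\|_{H^2_*(U)}$. $H^4_*(U)$ is the set of $u\in H^4(U)$ such that $u\in H^2_*(U)$ and $u_{xx}\in H^2_*(U)$, equipped with the inner product $(u,v)_{H^4_*}=\int_U u_{xxxx}v_{xxxx}\,dx$. Both are Hilbert spaces. $L$ is the $L^2(U)$-valued operator $L u=u_{xxxx}$ with domain $H^4_*(U)$. Given functions $F,G:\mathbb{R}\to\mathbb{R}$, $\mathbf{f}\in C([0,\infty);L^2(U))$, $u_0\in H^4_*(U)$ and $u_1\in H^2_*(U)$, a global pseudo classical solution of the initial/boundary value problem is a function $\mathbf{u}:[0,\infty)\to L^2(U)$ such that $\mathbf{u}\in C([0,\infty),H^4_*(U))$, $\mathbf{u}\in C^1([0,\infty),H^2_*(U))$, $\mathbf{u}\in C^2([0,\infty),L^2(U))$, $\mathbf{u}(0)=u_0$, $\mathbf{u}'(0)=u_1$, and for all $\phi\in C_c^\infty(0,\infty)$ and all $v\in L^2(U)$, $$\int_0^\infty(\mathbf{u}''(t),v)_{L^2}\phi(t)\,dt=-\int_0^\infty\big[(L(\mathbf{u}(t)),v)_{L^2}+(F(\mathbf{u}'(t)),v)_{L^2}+(G(\mathbf{u}(t)),v)_{L^2}-(\mathbf{f}(t),v)_{L^2}\big]\phi(t)\,dt,$$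 where $F(\mathbf{u}'(t))$ and $G(\mathbf{u}(t))$ denote the compositions $x\mapsto F([\mathbf{u}'(t)](x))$ and $x\mapsto G([\mathbf{u}(t)](x))$. The solution $\hat u$ of the stationary boundary value problem (with $G\equiv 0$) is the element $\hat u\in H^4_*(U)$ with $\hat u_{xxxx}=\mathbf{f}(0)$ in $L^2(U)$; the boundary conditions are encoded in membership in $H^4_*(U)$. A nonnegative function $g$ on $[0,\infty)$ exhibits exponential decay if there exist constants $C>0$ and $r>0$ such that $g(t)\le Ce^{-rt}$ for all $t\ge 0$. *)

(* Defs.v *)
From HB Require Import structures.
From mathcomp Require Import all_boot all_order all_algebra.
From mathcomp Require Import all_classical all_reals all_analysis.

Set Implicit Arguments.
Unset Strict Implicit.
Unset Printing Implicit Defensive.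
Import Order.TTheory GRing.Theory Num.Theory.
Import numFieldNormedType.Exports.

Local Open Scope classical_set_scope.
Local Open Scope ring_scope.

Definition test_function (R : realType) (U : set R) (phi : R -> R) : Prop :=
  [/\ forall n x, derivable (derive1n n phi) x 1,
      compact (closure [set x | phi x != 0]) &
      closure [set x | phi x != 0] `<=` U].

Definition mesU (R : realType) (a b : R) :
    {measure set (measurableTypeR R) -> \bar R} :=
  mrestr lebesgue_measure (measurable_itv `]a, b[).

(* An element of L^2(a,b) is handled through a representative defined on the
   whole line; only its values on ]a, b[ matter, and equality of elements of
   L^2(a,b) is equality almost everywhere for [mesU a b]. *)
Notation L2 a b := (LfunType (mesU a b) (lee1n 2)).

Section Spaces.
Context {R : realType} {a b : R}.
Implicit Types (u v w : L2 a b) (k : nat).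

Definition L2ip (f g : R -> R) : R :=
  \int[lebesgue_measure]_(x in `]a, b[) (f x * g x).

Definition L2norm u : R := fine 'N[mesU a b]_2%:E[EFin \o u].

Definition is_weak_deriv k u w : Prop :=
  forall phi : R -> R, test_function `]a, b[ phi ->
    L2ip u (derive1n k phi) = (-1) ^+ k * L2ip w phi.

(* The weak derivative of order k of u, or 0 if there is none. *)
Definition wderiv k u : L2 a b := xget 0 [set w | is_weak_deriv k u w].

Definition Hk k : set (L2 a b) :=
  [set u | forall j, (j <= k)%N -> exists w, is_weak_deriv j u w].

Definition H1norm u : R :=
  Num.sqrt (L2norm u ^+ 2 + L2norm (wderiv 1 u) ^+ 2).

Definition H10 : set (L2 a b) :=
  [set u | Hk 1 u /\ forall e : R, 0 < e ->
    exists2 phi : L2 a b, test_function `]a, b[ phi & H1norm (u - phi) < e].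

Definition H2s : set (L2 a b) := H10 `&` Hk 2.
Definition H2s_ip u v : R := L2ip (wderiv 2 u) (wderiv 2 v).
Definition H2s_norm u : R := Num.sqrt (H2s_ip u u).

Definition H4s : set (L2 a b) :=
  [set u | [/\ Hk 4 u, H2s u & H2s (wderiv 2 u)]].
Definition H4s_ip u v : R := L2ip (wderiv 4 u) (wderiv 4 v).
Definition H4s_norm u : R := Num.sqrt (H4s_ip u u).

Definition opL u : L2 a b := wderiv 4 u.

End Spaces.

Arguments L2ip {R} a b f g.

(* Functions on [0, +oo[ are functions on R whose values at negative times are
   irrelevant; at time 0, limits are one-sided. *)
Section Evolution.
Context {R : realType} {a b : R}.
Implicit Types (X : set (L2 a b)) (N : L2 a b -> R) (u : R -> L2 a b).

Definition time_continuous_at N u (t : R) : Prop :=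
  N (u s - u t) @[s --> within [set s | 0 <= s] (nbhs t)] --> (0 : R).

Definition is_time_deriv_at N u (t : R) (w : L2 a b) : Prop :=
  N ((s - t)^-1 *: (u s - u t) - w)
    @[s --> within [set s | 0 <= s] (dnbhs t)] --> (0 : R).

(* u \in C^k([0, +oo[, X), for the subspace X of L^2(a,b) with norm N. *)
Fixpoint Ck X N (k : nat) u : Prop :=
  (forall t, 0 <= t -> X (u t)) /\
  match k with
  | 0 => forall t, 0 <= t -> time_continuous_at N u t
  | k'.+1 => exists2 du : R -> L2 a b,
      (forall t, 0 <= t -> is_time_deriv_at N u t (du t)) & Ck X N k' du
  end.

(* u'(t), as the derivative of an L^2-valued function. The derivative of a C^1
   function with values in H2s is the same element, since H2s embeds
   continuously in L^2. *)
Definition dt u (t : R) : L2 a b :=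
  xget 0 [set w | is_time_deriv_at L2norm u t w].

Definition pseudo_classical_solution (F G : R -> R) (f : R -> L2 a b)
    (u0 u1 : L2 a b) (u : R -> L2 a b) : Prop :=
  [/\ Ck H4s H4s_norm 0 u, Ck H2s H2s_norm 1 u & Ck setT L2norm 2 u] /\
  [/\ u 0 = u0 %[ae mesU a b], dt u 0 = u1 %[ae mesU a b] &
   forall (phi : R -> R) (v : L2 a b), test_function `]0, +oo[ phi ->
     \int[lebesgue_measure]_(t in `]0, +oo[)
        (L2ip a b (dt (dt u) t) v * phi t) =
     - \int[lebesgue_measure]_(t in `]0, +oo[)
        ((L2ip a b (opL (u t)) v
          + L2ip a b (F \o dt u t) v
          + L2ip a b (G \o u t) v
          - L2ip a b (f t) v) * phi t)].

Definition unique_pseudo_classical_solution (F G : R -> R) (f : R -> L2 a b)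
    (u0 u1 : L2 a b) (u : R -> L2 a b) : Prop :=
  pseudo_classical_solution F G f u0 u1 u /\
  forall v, pseudo_classical_solution F G f u0 u1 v ->
    forall t, 0 <= t -> v t = u t %[ae mesU a b].

Definition stationary_solution (G : R -> R) (g uhat : L2 a b) : Prop :=
  H4s uhat /\ (fun x => opL uhat x + G (uhat x)) = g %[ae mesU a b].

End Evolution.

Definition exponential_decay (R : realType) (g : R -> R) : Prop :=
  exists C r : R, [/\ 0 < C, 0 < r &
    forall t, 0 <= t -> g t <= C * expR (- (r * t))].

(* Main.v *)
(* Put w = u - uhat, so that w'' + w_xxxx + F(w') = 0 when paired with any
   element of L2.  The energy E = |w'|^2 + |w_xx|^2 satisfies
   E' = - 2 (F(w'), w') <= - 2 a1 |w'|^2, hence |w_xx|, and by the Sobolev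
   embedding sup |w|, stays bounded.  For small eps > 0 the functional
   V = E + 2 eps (w', w) is equivalent to E and V' <= - c V.  The only term of
   V' of undetermined sign is (F(w'), w); it is absorbed by the pointwise bound
   |F(z) y| <= M F(z) z + (k / M) y^2, valid for bounded y and all M >= 1, with
   M large.

   The Sobolev embedding and the integrations by parts in space are obtained by
   approximating elements of H10 by test functions, for which they reduce to the
   fundamental theorem of calculus. *)
Require Import Defs.
From mathcomp Require Import all_boot all_order all_algebra.
From mathcomp Require Import all_classical all_reals all_analysis.
From mathcomp Require Import measurable_realfun ring lra.
Set Implicit Arguments.
Unset Strict Implicit.
Unset Printing Implicit Defensive.
Import Order.TTheory GRing.Theory Num.Theory.
Import numFieldNormedType.Exports.

Local Open Scope classical_set_scope.
Local Open Scope ring_scope.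

(** * L2 of an interval *)

(** The equation is given only after integration against test functions of time, while the energy
    argument needs it at each instant, with [v] replaced by [w(t)] or [u'(t)]. For fixed [v] every
    term is continuous in [t > 0], so a variational lemma in time gives the equation for all [v] at
    all [t > 0], and [v] may then depend on [t]. The delicate term is [F(u')]: [F] may grow faster
    than linearly and then does not act on L2. But [u'] is continuous into H2s, which embeds in the
    bounded functions, and there uniform continuity of [F] on segments suffices.

    The order of choices matters: the initial energy bounds sup [|w|], which fixes [k]; then [M] is
    chosen in terms of [k], and [eps] in terms of [M]. The rate obtained may thus depend on the
    initial data.

    Weak derivatives and time derivatives are selected by choice, so identities between them hold
    almost everywhere only and are used through pairings and norms, which ignore null sets. *)

Lemma ae_mono d (T : semiRingOfSetsType d) (R : realFieldType)
    (mu : set T -> \bar R) (P Q : T -> Prop) : (forall x, P x -> Q x) ->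
  {ae mu, forall x, P x} -> {ae mu, forall x, Q x}.
Proof.
by move=> PQ [N [mN N0 PN]]; exists N; split=> // x nQ; apply: PN => /= /PQ.
Qed.

Lemma ae_and d (T : ringOfSetsType d) (R : realFieldType)
    (mu : {measure set T -> \bar R}) (P Q : T -> Prop) :
  {ae mu, forall x, P x} -> {ae mu, forall x, Q x} ->
  {ae mu, forall x, P x /\ Q x}.
Proof. exact: filterI. Qed.

Section L2space.
Context {R : realType} {a b : R}.
Implicit Types (u v w : L2 a b).
Local Notation mu := (@lebesgue_measure R).

Lemma mesU_setT : mesU a b setT = mu `]a, b[.
Proof. by rewrite /mesU/= /mrestr setTI. Qed.

Lemma mesU_fin_num : mesU a b setT \is a fin_num.
Proof.
rewrite mesU_setT lebesgue_measure_itv/=; case: ifP => // _.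
Qed.

Lemma mesU_setC : mesU a b (~` `]a, b[) = 0%E.
Proof. by rewrite /mesU/= /mrestr setICl measure0. Qed.

Lemma integral_mesU (f : R -> \bar R) : (mesU a b).-integrable setT f ->
  (\int[mesU a b]_x f x = \int[mu]_(x in `]a, b[) f x)%E.
Proof.
move=> intf.
rewrite (@negligible_integral _ (measurableTypeR R) R (mesU a b) setT
  (~` `]a, b[))//; last first.
- exact: mesU_setC.
- exact: measurableC.
rewrite setTD setCK; apply: eq_measure_integral => A mA AU.
by rewrite /mesU/= /mrestr (setIidl AU).
Qed.

Lemma L2mul_integrable u v :
  (mesU a b).-integrable setT (EFin \o (fun x => u x * v x)).
Proof.
by apply/Lfun1_integrable/Lfun2_mul_Lfun1; exact: LfunP.
Qed.

Lemma L2ipE u v : L2ip a b u v = \int[mesU a b]_x (u x * v x).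
Proof. by rewrite /L2ip /Rintegral integral_mesU//; exact: L2mul_integrable. Qed.

Lemma L2ipC (f g : R -> R) : L2ip a b f g = L2ip a b g f.
Proof. by apply: eq_Rintegral => x _; rewrite mulrC. Qed.

Lemma L2ipDl u v w : L2ip a b (u + v) w = L2ip a b u w + L2ip a b v w.
Proof.
rewrite !L2ipE -RintegralD//; do ?exact: L2mul_integrable.
by apply: eq_Rintegral => x _; rewrite -mulrDl.
Qed.

Lemma L2ipZl (k : R) u w : L2ip a b (k *: u) w = k * L2ip a b u w.
Proof.
rewrite !L2ipE -RintegralZl//; do ?exact: L2mul_integrable.
by apply: eq_Rintegral => x _; rewrite mulrA.
Qed.

Lemma L2ipNl u w : L2ip a b (- u) w = - L2ip a b u w.
Proof. by rewrite -scaleN1r L2ipZl mulN1r. Qed.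

Lemma L2ipBl u v w : L2ip a b (u - v) w = L2ip a b u w - L2ip a b v w.
Proof. by rewrite L2ipDl L2ipNl. Qed.

Lemma L2ipDr u v w : L2ip a b w (u + v) = L2ip a b w u + L2ip a b w v.
Proof. by rewrite L2ipC L2ipDl !(L2ipC w). Qed.

Lemma L2ipZr (k : R) u w : L2ip a b w (k *: u) = k * L2ip a b w u.
Proof. by rewrite L2ipC L2ipZl (L2ipC w). Qed.

Lemma L2ipNr u w : L2ip a b w (- u) = - L2ip a b w u.
Proof. by rewrite L2ipC L2ipNl (L2ipC w). Qed.

Lemma L2ipBr u v w : L2ip a b w (u - v) = L2ip a b w u - L2ip a b w v.
Proof. by rewrite L2ipDr L2ipNr. Qed.

Lemma L2ip_ge0 u : 0 <= L2ip a b u u.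
Proof. by apply: Rintegral_ge0 => x _; exact: sqr_ge0. Qed.

Lemma L2norm_ge0 u : 0 <= L2norm u.
Proof. exact/fine_ge0/Lnorm_ge0. Qed.

Lemma L2norm_sqr u : L2norm u ^+ 2 = L2ip a b u u.
Proof.
rewrite L2ipE -powR_mulrn ?L2norm_ge0// /L2norm -fine_poweR powR_Lnorm//.
congr fine; apply: eq_integral => x _ /=; congr EFin.
by rewrite powR_mulrn ?normr_ge0// real_normK ?num_real// expr2.
Qed.

Lemma L2normE u : L2norm u = Num.sqrt (L2ip a b u u).
Proof. by rewrite -L2norm_sqr sqrtr_sqr ger0_norm// L2norm_ge0. Qed.

Lemma L2ip_CS u v : `|L2ip a b u v| <= L2norm u * L2norm v.
Proof.
have [u0|u0] := eqVneq (L2norm u) 0.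
  have /= := @fine_Lnormr_eq0 _ _ _ (mesU a b) _ (lee1n 2) u u0.
  move=> ae0; rewrite u0 mul0r normr_le0; apply/eqP.
  rewrite L2ipE /Rintegral (@ae_eq_integral _ _ _ _ _ (cst 0%E))//.
  - by rewrite integral0.
  - by apply/measurable_EFinP/measurable_funM.
  - by apply: filterS ae0 => x /(_ I) /= -> _; rewrite mul0r.
(* This vector is [|u|^2] times the component of [v] orthogonal to [u]; its squared norm is
   [|u|^2 * (|u|^2 * |v|^2 - (u, v)^2)]. *)
have := L2ip_ge0 (L2norm u ^+ 2 *: v - L2ip a b u v *: u).
rewrite L2ipBl !L2ipBr !L2ipZl !L2ipZr -!L2norm_sqr (L2ipC v u).
set x := L2ip a b u v => h.
have up : 0 < L2norm u by rewrite lt_neqAle eq_sym u0 L2norm_ge0.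
rewrite -(@ler_pXn2r _ 2)// ?nnegrE ?normr_ge0// ?mulr_ge0 ?L2norm_ge0//.
rewrite real_normK ?num_real// exprMn.
have u2 : 0 < L2norm u ^+ 2 by rewrite exprn_gt0.
rewrite -subr_ge0 -(pmulr_rge0 _ u2).
by apply: le_trans h _; rewrite le_eqVlt; apply/orP; left; apply/eqP; ring.
Qed.

Lemma L2normZ (k : R) u : L2norm (k *: u) = `|k| * L2norm u.
Proof.
rewrite !L2normE L2ipZl L2ipZr mulrA -expr2 sqrtrM ?sqr_ge0//.
by rewrite sqrtr_sqr.
Qed.

Lemma L2normN u : L2norm (- u) = L2norm u.
Proof. by rewrite -scaleN1r L2normZ normrN1 mul1r. Qed.

Lemma L2normD u v : L2norm (u + v) <= L2norm u + L2norm v.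
Proof. exact: ler_LnormD. Qed.

Lemma L2normB u v : L2norm (u - v) <= L2norm u + L2norm v.
Proof. by rewrite (le_trans (L2normD _ _))// L2normN. Qed.

Lemma L2norm_eq0 u : L2norm u = 0 <-> u = 0 %[ae mesU a b].
Proof.
split; first exact: fine_Lnormr_eq0.
move=> ae0; rewrite L2normE L2ipE /Rintegral.
rewrite (@ae_eq_integral _ _ _ _ _ (cst 0%E))//.
- by rewrite integral0 sqrtr0.
- by apply/measurable_EFinP/measurable_funM.
- by apply: filterS ae0 => x /(_ I) /= -> _; rewrite mul0r.
Qed.

(** The complement of the interval is [mesU]-null, so it can be added to the exceptional set. *)
Lemma ae_mesU (P : R -> Prop) :
  {ae mesU a b, forall x, P x} <-> {ae mu, forall x, `]a, b[%classic x -> P x}.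
Proof.
split=> -[N [mN N0 PN]].
- exists (N `&` `]a, b[%classic); split; first exact: measurableI.
    by move: N0; rewrite /mesU/= /mrestr.
  by move=> x /= /not_implyP[xab nP]; split=> //; apply: PN.
- exists (N `|` ~` `]a, b[%classic); split.
  + by apply: measurableU => //; exact: measurableC.
  + apply/eqP; rewrite -measure_le0; apply: le_trans.
      by apply: measureU2 => //; exact: measurableC.
    rewrite [X in (_ + X)%E](_ : _ = 0%E) ?adde0; last exact: mesU_setC.
    rewrite -[leRHS]N0 /mesU/= /mrestr.
    by apply: le_measure; rewrite ?inE//; exact: measurableI.
  + move=> x /= nP; have [xab|] := pselect (`]a, b[%classic x); last by right.
    by left; apply: PN => /= /(_ xab).
Qed.

Lemma ae_eq_mesU (f g : R -> R) : f = g %[ae mesU a b] <->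
  {ae mu, forall x, `]a, b[%classic x -> f x = g x}.
Proof.
split=> [fg|/ae_mesU fg].
  by apply/ae_mesU; apply: ae_mono fg => x /(_ I).
by apply: ae_mono fg => x fg _.
Qed.

Lemma L2sub_eq0 u v : L2norm (u - v) = 0 <-> u = v %[ae mesU a b].
Proof.
rewrite L2norm_eq0; split; apply: filterS => x /(_ I) h _.
  by apply/subr0_eq; exact: h.
by transitivity (u x - v x) => //; rewrite h subrr.
Qed.

Lemma L2ip_ae u v w : u = v %[ae mesU a b] -> L2ip a b u w = L2ip a b v w.
Proof.
move=> /L2sub_eq0 uv; apply/eqP; rewrite -subr_eq0 -L2ipBl -normr_le0.
by rewrite (le_trans (L2ip_CS _ _))// uv mul0r.
Qed.

Lemma L2ip_aer u v w : u = v %[ae mesU a b] -> L2ip a b w u = L2ip a b w v.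
Proof. by rewrite !(L2ipC w); exact: L2ip_ae. Qed.

Lemma L2norm_ae u v : u = v %[ae mesU a b] -> L2norm u = L2norm v.
Proof. by move=> uv; rewrite !L2normE (L2ip_ae _ uv) (L2ip_aer _ uv). Qed.

(** The measure is finite, so a constant dominates. The element obtained is [f] itself as a
    function, not just almost everywhere, which allows rewriting with the equation. *)
Lemma bounded_L2 (f : measurableTypeR R -> R) (K : R) :
  measurable_fun setT f ->
  {ae mu, forall x, `]a, b[%classic x -> `|f x| <= K} ->
  exists v : L2 a b, v = f :> (R -> R).
Proof.
move=> mf /ae_mesU fK.
suff Lf : f \in Lfun (mesU a b) 2%:E by exists (Lfun_Sub (lee1n 2) Lf).
apply/andP; split; first by rewrite inE.
rewrite inE/= /finite_norm unlock /Lnorm poweR_lty//.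
apply: (@le_lt_trans _ _ (\int[mesU a b]_x (K `^ 2)%:E)%E); last first.
  rewrite integral_cst// ltey_eq fin_numM//; exact: mesU_fin_num.
apply: ae_ge0_le_integral => //.
- by move=> x _; rewrite lee_fin powR_ge0.
- apply/measurable_EFinP.
  apply: (@measurableT_comp _ _ _ _ _ _ (@powR R ^~ 2)) => //.
  exact: measurableT_comp.
- by move=> x _; rewrite lee_fin powR_ge0.
- apply: ae_mono fK => x fxK _; rewrite lee_fin ge0_ler_powR//.
  by rewrite nnegrE (le_trans _ fxK).
Qed.

End L2space.

(** * Smooth bump functions *)

Section flat_functions.
Context {R : realType}.
Implicit Types (p q r z : {poly R}) (x : R).

(** Induction on the Horner form, with half of the exponent spent on the new factor:
    [y <= 2 / e * expR (e / 2 * y)]. *)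
Lemma poly_le_expR p (e : R) : 0 < e ->
  exists2 C : R, 0 <= C & forall y, 0 <= y -> `|p.[y]| <= C * expR (e * y).
Proof.
elim/poly_ind: p e => [|p c IH] e e0.
  by exists 0 => // y _; rewrite horner0 normr0 mul0r.
have e20 : 0 < e / 2 by rewrite divr_gt0.
have [C C0 HC] := IH _ e20.
exists (C * (2 / e) + `|c|) => [|y y0].
  by rewrite addr_ge0// mulr_ge0// divr_ge0// ltW.
rewrite hornerMXaddC (le_trans (ler_normD _ _))// mulrDl lerD//.
  rewrite normrM (ger0_norm y0).
  have y1 : y <= 2 / e * expR (e / 2 * y).
    rewrite -ler_pdivrMl ?divr_gt0// invf_div.
    by rewrite (le_trans _ (expR_ge1Dx _))// lerDr.
  have -> : e * y = e / 2 * y + e / 2 * y by lra.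
  rewrite expRD; apply: le_trans (ler_pM _ _ (HC _ y0) y1) _ => //.
  by rewrite le_eqVlt; apply/orP; left; apply/eqP; ring.
rewrite ler_peMr// -expR0 ler_expR mulr_ge0// ltW//.
Qed.

(** For [p = 1] this is the classical smooth function vanishing to infinite order at 0; the
    polynomial in [x^-1] makes the family stable under differentiation. *)
Definition flat p x : R := if 0 < x then p.[x^-1] * expR (- x^-1) else 0.

Lemma flat_le0 p x : x <= 0 -> flat p x = 0.
Proof. by rewrite /flat; case: ltP. Qed.

Lemma flat_bound p : exists2 C : R, 0 <= C &
  forall x, `|flat p x| <= C * `|x|.
Proof.
have [C C0 HC] := poly_le_expR (p * 'X) (@ltr01 R).
exists C => // x; rewrite /flat; case: ltP => x0; last first.
  by rewrite normr0 mulr_ge0.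
rewrite (gtr0_norm x0) -ler_pdivrMr// normrM (gtr0_norm (expR_gt0 _)).
have xV : 0 <= x^-1 by rewrite invr_ge0 ltW.
rewrite mulrAC expRN ler_pdivrMr ?expR_gt0//.
by have := HC _ xV; rewrite hornerMX mul1r normrM (ger0_norm xV).
Qed.

Lemma flat_cvg0 p : flat p x @[x --> 0] --> (0 : R).
Proof.
have [C C0 HC] := flat_bound p.
apply/cvgrPdist_le => e e0.
have d0 : 0 < e / (C + 1) by rewrite divr_gt0// ltr_wpDl.
near=> x.
rewrite sub0r normrN (le_trans (HC x))//.
have : `|x| <= e / (C + 1).
  near: x.
  have := @nbhs0_le R R _ d0; exact.
rewrite ler_pdivlMr ?ltr_wpDl//; apply: le_trans.
by rewrite mulrC ler_wpM2l// lerDl.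
Unshelve. all: by end_near. Qed.

(** With [y = 1 / x] one has [dy/dx = - y^2], and the derivative of [p(y) exp(- y)] in [y] is
    [(p' - p)(y) exp(- y)]. *)
Definition dflat p : {poly R} := 'X ^+ 2 * (p - p^`()).

Lemma is_derive_flat p x : is_derive x 1 (flat p) (flat (dflat p) x).
Proof.
have [x0|x0|->] := ltgtP x 0.
- rewrite flat_le0 ?ltW//; apply: (@near_eq_is_derive _ _ _ (cst 0)).
  near=> y; rewrite flat_le0//; apply: ltW.
  near: y; exact: lt_nbhsl.
- have dV : is_derive x (1 : R) (fun z : R => z^-1) (- x ^- 2 *: 1).
    by apply: (@is_deriveV _ id); rewrite ?gt_eqF//; exact: is_derive_id.
  pose g : R -> R := (horner p \o (fun z : R => z^-1))
                     * (expR \o (- (fun z : R => z^-1))).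
  have dg : is_derive x 1 g (flat (dflat p) x).
    apply: is_derive_eq.
    rewrite /flat x0 /dflat !hornerE /= /GRing.scale/= !expr2 invfM.
    rewrite [X in expR X](_ : _ = - x^-1)//.
    by ring.
  apply: near_eq_is_derive dg.
  near=> y; rewrite /flat /= ifT//; near: y; exact: lt_nbhsr.
- rewrite flat_le0//; apply/is_derive1_caratheodory.
  (* The difference quotient at 0 is [flat p z / z], again a member of the family, and so it tends
     to 0. *)
  exists (flat (p * 'X)); split.
  + move=> z; rewrite (flat_le0 _ (lexx 0)) !subr0 /flat.
    case: ltP => z0; last by rewrite mul0r.
    rewrite hornerMX -[LHS]mulr1 -(@mulVf _ z) ?gt_eqF//; ring.
  + by rewrite /prop_for /continuous_at flat_le0//; exact: flat_cvg0.
  + by rewrite flat_le0.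
Unshelve. all: by end_near. Qed.

Lemma flat1_le1 x : 0 <= flat 1 x <= 1.
Proof.
rewrite /flat; case: ltP => x0; last by rewrite lexx ler01.
rewrite hornerE mul1r expR_ge0/= -expR0 ler_expR oppr_le0 invr_ge0 ltW//.
Qed.

End flat_functions.

Section bump_functions.
Context {R : realType}.
Implicit Types (s : seq ({poly R} * {poly R})) (z : {poly R}).

(* Functions of this form are stable under differentiation. *)
Definition flat_sum z s (x : R) : R :=
  \sum_(q <- s) q.1.[x] * flat q.2 z.[x].

Definition dflat_sum z s :=
  flatten [seq [:: (q.1^`()%R, q.2); (q.1 * z^`()%R, dflat q.2)] | q <- s].

Lemma is_derive_flat_sum z s (x : R) :
  is_derive x 1 (flat_sum z s) (flat_sum z (dflat_sum z s) x).
Proof.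
elim: s => [|[r p] s IH].
  rewrite (_ : flat_sum z [::] = cst 0).
    exact: is_derive_cst.
  by apply/funext => y; rewrite /flat_sum big_nil.
rewrite (_ : flat_sum z _ = (horner r * (flat p \o horner z)) + flat_sum z s).
  have dp := is_derive_flat p z.[x].
  apply: is_derive_eq.
  rewrite [in RHS]/flat_sum /dflat_sum /= !big_cons /= addrA; congr (_ + _).
  by rewrite !hornerE /GRing.scale/=; ring.
by apply/funext => y; rewrite /flat_sum big_cons.
Qed.

Lemma derive1n_flat_sum z s n :
  derive1n n (flat_sum z s) = flat_sum z (iter n (dflat_sum z) s).
Proof.
elim: n => // n IH; rewrite derive1nS IH; apply/funext => x.
by rewrite derive1E; have D := is_derive_flat_sum z (iter n (dflat_sum z) s) x;
  rewrite derive_val.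
Qed.

Definition bump (c d : R) (n : nat) (x : R) : R :=
  flat 1 (n%:R * ((x - c) * (d - x))).

Lemma bumpE c d n :
  bump c d n = flat_sum (n%:R%:P * (('X - c%:P) * (d%:P - 'X))) [:: (1, 1)].
Proof.
apply/funext => x.
by rewrite /flat_sum /bump big_seq1 !hornerE.
Qed.

Lemma bump_smooth c d n k x : derivable (derive1n k (bump c d n)) x 1.
Proof.
rewrite bumpE derive1n_flat_sum.
by have [] := is_derive_flat_sum (n%:R%:P * (('X - c%:P) * (d%:P - 'X)))
  (iter k (dflat_sum (n%:R%:P * (('X - c%:P) * (d%:P - 'X)))) [:: (1, 1)]) x.
Qed.

Lemma bump_out c d n x : c <= d -> x \notin `]c, d[ -> bump c d n x = 0.
Proof.
move=> cd xcd; apply: flat_le0; rewrite mulr_ge0_le0//.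
move: xcd; rewrite in_itv/= negb_and -!leNgt => /orP[xc|dx].
  by rewrite mulr_le0_ge0 ?subr_le0 ?subr_ge0// (le_trans xc).
by rewrite mulr_ge0_le0 ?subr_le0 ?subr_ge0// (le_trans _ dx).
Qed.

Lemma bump_ge0_le1 c d n x : 0 <= bump c d n x <= 1.
Proof. exact: flat1_le1. Qed.

Lemma bump_gt0 c d n x : x \in `]c, d[ -> 0 < bump c d n.+1 x.
Proof.
rewrite in_itv/= => /andP[cx xd]; rewrite /bump /flat.
by rewrite ifT ?hornerE ?mul1r ?expR_gt0// !mulr_gt0 ?subr_gt0.
Qed.

Lemma bump_test (U : set R) c d n : c <= d -> `[c, d] `<=` U ->
  test_function U (bump c d n).
Proof.
move=> cd cdU.
have sub : closure [set x | bump c d n x != 0] `<=` `[c, d].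
  have /closure_id -> : closed `[c, d]%classic by exact: interval_closed.
  apply: closure_subset => x /=; apply: contra_neqP => /negP xcd.
  apply: bump_out => //; apply: contraNN xcd.
  by rewrite !in_itv/= => /andP[/ltW -> /ltW ->].
split.
- by move=> k x; exact: bump_smooth.
- apply: (subclosed_compact _ (@segment_compact _ c d)) => //.
  exact: closed_closure.
- by apply: subset_trans cdU.
Qed.

Lemma bump_cvg c d x : c <= d ->
  bump c d n x @[n --> \oo] --> ((x \in `]c, d[)%:R : R).
Proof.
move=> cd; have [xcd|xcd] := boolP (x \in `]c, d[); last first.
  by under eq_fun do rewrite bump_out//; exact: cvg_cst.
have z0 : 0 < (x - c) * (d - x).
  by move: xcd; rewrite in_itv/= => /andP[cx xd]; rewrite mulr_gt0 ?subr_gt0.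
(* [bump c d 0] is the zero function; the exponential formula starts at index 1. *)
rewrite -cvg_shiftS /=.
rewrite (_ : (fun n => _) =
    (fun n => expR (- ((x - c) * (d - x))^-1 * harmonic n))).
  have <- : expR (- ((x - c) * (d - x))^-1 * 0) = 1%:R :> R.
    by rewrite mulr0 expR0.
  apply: continuous_cvg; first exact: continuous_expR.
  apply: cvgMr; exact: cvg_harmonic.
apply/funext => n.
rewrite /bump /flat ifT.
  by rewrite hornerE mul1r /harmonic/= invfM mulNr mulrC.
by apply: mulr_gt0.
Qed.

End bump_functions.

(** * The fundamental lemma of the calculus of variations *)

Section fundamental_lemma.
Context {R : realType} {a b : R}.
Local Notation mu := (@lebesgue_measure R).

Lemma ge0_integral_mesU (f : measurableTypeR R -> \bar R) :
  measurable_fun setT f -> (forall x, 0 <= f x)%E ->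
  (\int[mesU a b]_x f x = \int[mu]_(x in `]a, b[) f x)%E.
Proof.
move=> mf f0.
rewrite (@ge0_negligible_integral _ (measurableTypeR R) R (mesU a b) setT
  (~` `]a, b[))//; last first.
- exact: mesU_setC.
- exact: measurableC.
rewrite setTD setCK; apply: eq_measure_integral => A mA AU.
by rewrite /mesU/= /mrestr (setIidl AU).
Qed.

Lemma L2_integrable (w : L2 a b) : mu.-integrable `]a, b[ (EFin \o w).
Proof.
have /Lfun1_integrable/integrableP[mw fw] : (w : _ -> R) \in Lfun (mesU a b) 1.
  by apply: Lfun_subset12; [exact: mesU_fin_num|exact: LfunP].
apply/integrableP; split; first exact: measurable_funTS.
by rewrite -ge0_integral_mesU//; exact: measurableT_comp.
Qed.

(* On ]c, d[ the functions bump c d n = exp(- 1 / (n (x - c) (d - x))) increase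
   to 1, and they vanish elsewhere. *)
Lemma bump_integral0 (w : L2 a b) (c d : R) :
  (forall phi, test_function `]a, b[ phi -> L2ip a b w phi = 0) ->
  a < c -> c <= d -> d < b -> \int[mu]_(x in `]c, d[) w x = 0.
Proof.
move=> w0 ac cd db.
have cdab : `[c, d]%classic `<=` `]a, b[%classic.
  move=> x /=; rewrite !in_itv/= => /andP[cx xd].
  by rewrite (lt_le_trans ac)//= (le_lt_trans _ db).
have cdab' : `]c, d[%classic `<=` `]a, b[%classic.
  by apply: subset_trans cdab => x /=; rewrite !in_itv/= => /andP[/ltW-> /ltW->].
have iw := L2_integrable w.
have /integrableP[/measurable_EFinP mw _] := iw.
rewrite -[X in Rintegral _ X _](setIidr cdab') Rintegral_mkcondr.
have [] := @dominated_convergence _ _ R mu `]a, b[%classic (measurable_itv _)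
  (fun n x => (w x * bump c d n x)%:E) (fun x => ((w \_ `]c, d[) x)%:E)
  (fun x => `|(w x)%:E|%E).
- move=> n; apply/measurable_EFinP/measurable_funM => //.
  apply: measurable_funTS; apply: continuous_measurable_fun => x.
  have /derivable1_diffP/differentiable_continuous h := @bump_smooth R c d n 0 x.
  exact: h.
- by apply/measurable_EFinP; apply/measurable_restrict => //;
    exact: measurable_funTS.
- apply: aeW => x _; apply/cvg_EFin; first exact: nearW.
  rewrite patchE mem_setE.
  rewrite (_ : (if _ then _ else _) = w x * (x \in `]c, d[)%:R); last first.
    by case: ifP => _; rewrite ?mulr1 ?mulr0.
  by apply: cvgMr; exact: bump_cvg.
- exact: integrable_abse.
- apply: aeW => x n _; rewrite lee_fin normrM ler_piMr//.
  by have /andP[h0 h1] := bump_ge0_le1 c d n x; rewrite ger0_norm.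
move=> iwcd _; rewrite -(fineK (integrable_fin_num _ iwcd))// => /fine_cvg.
rewrite (_ : fine \o _ = cst 0).
  move=> h0; apply/esym; exact: (cvg_unique _ (cvg_cst (0 : R)) h0).
apply/funext => n /=.
by rewrite -[LHS]/(L2ip a b w (bump c d n)) w0//; exact: bump_test.
Qed.

(** The integrals of [w] over inner intervals vanish, so its primitive is constant inside []a, b[],
    and Lebesgue differentiation recovers [w] from the primitive almost everywhere. No mollification
    is involved. *)
Lemma ae_eq0_of_test (w : L2 a b) :
  (forall phi, test_function `]a, b[ phi -> L2ip a b w phi = 0) ->
  w = 0 %[ae mesU a b].
Proof.
move=> w0.
have iw := L2_integrable w.
pose g : R -> R := w \_ `]a, b[.
have ig : mu.-integrable setT (EFin \o g).
  by rewrite -restrict_EFin; apply/integrable_restrict => //; rewrite setTI.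
have igS D : measurable D -> mu.-integrable D (EFin \o g).
  by move=> mD; apply: integrableS ig.
have := @FTC1 R g (BLeft a) (fun y => igS _ (measurable_itv _))
  (open_integrable_locally openT ig).
move=> h; apply/ae_eq_mesU.
apply: ae_mono h => /= x + xab.
have /andP[ax xb] : a < x < b by move: xab; rewrite /= in_itv.
rewrite lte_fin => /(_ ax)[dF].
rewrite /g patchE mem_set// => <-.
rewrite derive1E.
pose F (y : R) := \int[mu]_(t in `[a, y]) g t; rewrite -/F.
have Fcst y z : a < y -> y <= z -> z < b -> F y = F z.
  move=> ay yz zb; apply/esym/eqP; rewrite -subr_eq0; apply/eqP.
  rewrite /F Rintegral_itvB ?bnd_simp//; last 2 first.
  - exact: igS.
  - exact: ltW.
  rewrite -Rintegral_itv_bndo_bndc; last exact: igS.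
  rewrite -(bump_integral0 w0 ay yz zb).
  apply: eq_Rintegral => t; rewrite inE/= in_itv/= => /andP[yt tz].
  rewrite /g patchE mem_set//= in_itv/= (lt_trans ay yt)/=.
  by rewrite (lt_trans tz).
rewrite (@near_eq_derive _ _ _ F (cst (F x))) ?derive_cst//.
near=> y.
have ay : a < y by near: y; exact: lt_nbhsr.
have yb : y < b by near: y; exact: lt_nbhsl.
by case: (leP x y) => [xy|/ltW yx]; [apply/esym|]; exact: Fcst.
Unshelve. all: by end_near. Qed.

Lemma continuous_measurableTypeR (f : R -> R) : continuous f ->
  measurable_fun setT (f : measurableTypeR R -> R).
Proof. by move=> cf; exact: continuous_measurable_fun. Qed.

Lemma test_function_continuous (U : set R) (phi : R -> R) k :
  test_function U phi -> continuous (derive1n k phi).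
Proof.
move=> [dphi _ _] x.
have /derivable1_diffP/differentiable_continuous h := dphi k x.
exact: h.
Qed.

Lemma continuous_L2 (f : R -> R) : continuous f ->
  exists v : L2 a b, v = f :> (R -> R).
Proof.
move=> cf.
have [K fK] : exists K : R, forall x, x \in `[a, b] -> `|f x| <= K.
  have [ab|ba] := leP a b; last first.
    exists 0 => x; rewrite in_itv/= => /andP[/le_trans/[apply]].
    by rewrite leNgt ba.
  have [|c _ cP] := @EVT_max R (fun x => `|f x|) a b ab.
    apply: continuous_subspaceT => x; apply: continuous_comp; first exact: cf.
    exact: norm_continuous.
  by exists `|f c|.
apply: (bounded_L2 (K := K)); first exact: continuous_measurableTypeR.
by apply: aeW => x; rewrite /= in_itv/= => /andP[/ltW ax /ltW xb];
  rewrite fK// in_itv/= ax.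
Qed.

Lemma ae_eq_of_test (u v : L2 a b) :
  (forall phi, test_function `]a, b[ phi -> L2ip a b u phi = L2ip a b v phi) ->
  u = v %[ae mesU a b].
Proof.
move=> uv; apply/L2sub_eq0/L2norm_eq0/ae_eq0_of_test => phi tphi.
have [q qE] := continuous_L2 (test_function_continuous (k := 0) tphi).
by rewrite -[phi]qE L2ipBl qE uv// subrr.
Qed.

End fundamental_lemma.

(** * Order and pointwise bounds in L2 *)

Section L2order.
Context {R : realType} {a b : R}.
Implicit Types (u v w : L2 a b).
Local Notation mu := (@lebesgue_measure R).

(** The integral is compared under a pointwise inequality, while the hypothesis holds almost
    everywhere; the left integrand is therefore replaced by its minimum with the right one, which
    changes it on a null set only. Two products stand on the right because the bound on the cross
    term of the damping has two. *)
Lemma L2ip_leD u v u' v' u'' v'' :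
  {ae mu, forall x, `]a, b[%classic x ->
    u x * v x <= u' x * v' x + u'' x * v'' x} ->
  L2ip a b u v <= L2ip a b u' v' + L2ip a b u'' v''.
Proof.
move=> le_ae; rewrite !L2ipE.
pose f x := u x * v x; pose g x := u' x * v' x + u'' x * v'' x.
have mf : measurable_fun setT f by apply: measurable_funM.
have mg : measurable_fun setT g.
  by apply: measurable_funD; apply: measurable_funM.
have [intf intg1] := (L2mul_integrable u v, L2mul_integrable u' v').
have intg2 := L2mul_integrable u'' v''.
have intg : (mesU a b).-integrable setT (EFin \o g).
  exact: (integrableD measurableT intg1 intg2).
have fm : f = (fun x => Num.min (f x) (g x)) %[ae mesU a b].
  apply/ae_eq_mesU; apply: ae_mono le_ae => x fg xab.
  by rewrite min_l//; exact: fg.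
have mm : measurable_fun setT (fun x => Num.min (f x) (g x)).
  exact: measurable_minr.
have intm : (mesU a b).-integrable setT (EFin \o (fun x => Num.min (f x) (g x))).
  apply: (@le_integrable _ _ _ _ _ _ _ (fun x => `|(f x)%:E| + `|(g x)%:E|)%E) => //.
  - exact/measurable_EFinP.
  - move=> x _ /=; rewrite lee_fin (ger0_norm (addr_ge0 _ _))//.
    by rewrite /Num.min; case: ifP => _; rewrite ?lerDl ?lerDr.
  - by apply: integrableD => //; exact: integrable_abse.
rewrite -RintegralD//.
rewrite [leLHS](_ : _ = \int[mesU a b]_x Num.min (f x) (g x)).
  apply: le_Rintegral => // x _; rewrite ge_min lexx orbT//.
congr fine; apply: ae_eq_integral => //.
- exact/measurable_EFinP.
- exact/measurable_EFinP.
- by apply: ae_mono fm => x h /h fgx; congr EFin; exact: fgx.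
Qed.

Lemma L2ip_le u v u' v' :
  {ae mu, forall x, `]a, b[%classic x -> u x * v x <= u' x * v' x} ->
  L2ip a b u v <= L2ip a b u' v'.
Proof.
move=> le_ae; rewrite -[leRHS]addr0 -(mul0r (L2ip a b u' v')) -L2ipZl.
apply: L2ip_leD; apply: ae_mono le_ae => x h /h uv.
by rewrite (le_trans uv)// lerDl [leRHS](_ : _ = 0 * u' x * v' x)// !mul0r.
Qed.

Definition L2one : L2 a b :=
  sval (cid (continuous_L2 (@cst_continuous _ _ (1 : R)))).

Lemma L2oneE : L2one = (fun=> 1) :> (R -> R).
Proof. by rewrite /L2one; case: cid. Qed.

Lemma L2norm_one : a < b -> L2norm L2one = Num.sqrt (b - a).
Proof.
move=> ab; rewrite L2normE /L2ip L2oneE; congr Num.sqrt.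
under eq_Rintegral do rewrite mulr1.
rewrite Rintegral_cst// mul1r; have /= := @lebesgue_measure_itv R `]a, b[.
by rewrite lte_fin ab => ->.
Qed.

Lemma L2norm_le_bound u K : a < b ->
  {ae mu, forall x, `]a, b[%classic x -> `|u x| <= K} -> 0 <= K ->
  L2norm u <= K * Num.sqrt (b - a).
Proof.
move=> ab uK K0; rewrite -L2norm_one//.
have -> : K * L2norm L2one = L2norm (K *: L2one) by rewrite L2normZ ger0_norm.
rewrite !L2normE ler_wsqrtr//; apply: L2ip_le.
apply: ae_mono uK => x h xab; rewrite [leRHS](_ : _ = (K * L2one x) * (K * L2one x))//.
rewrite L2oneE mulr1 -!expr2 -real_normK ?num_real//.
by rewrite ler_pXn2r ?nnegrE// h.
Qed.

(* Pairing with the indicator of {v > K} passes to the limit in phi. *)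
Lemma ae_le_of_approx v K :
  (forall e, 0 < e -> exists2 phi : L2 a b,
     (forall x, `]a, b[%classic x -> phi x <= K + e) & L2norm (v - phi) <= e) ->
  {ae mu, forall x, `]a, b[%classic x -> v x <= K}.
Proof.
move=> H.
pose A := [set x | K < v x].
have mA : measurable (A : set (measurableTypeR R)).
  have mv : measurable_fun setT (v : measurableTypeR R -> R) by [].
  have mlt := measurable_fun_ltr (measurable_cst K) mv.
  have := mlt measurableT [set true] I.
  by rewrite setTI; congr measurable; apply/seteqP; split.
have [psi psiE] : exists w : L2 a b, w = \1_A :> (R -> R).
  apply: (bounded_L2 (K := 1)); first exact: measurable_indic.
  by apply: aeW => x _; rewrite indicE; case: (_ \in _); rewrite ?normr1 ?normr0.
pose q := v - K *: L2one.
have qE x : q x = v x - K.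
  by rewrite -[K in RHS]mulr1 -[X in _ * X](congr1 (@^~ x) L2oneE).
have qpsi x : 0 <= q x * psi x.
  rewrite qE psiE indicE; have [|_] := boolP (x \in A); last by rewrite mulr0.
  by rewrite inE /A/= mulr1 subr_ge0 => /ltW.
have q0 : L2ip a b q psi <= 0.
  apply/ler_addgt0Pr => e e0; rewrite add0r.
  set c := L2ip a b L2one psi.
  have c0 : 0 <= c.
    apply: Rintegral_ge0 => x _; rewrite L2oneE mul1r psiE indicE.
    by case: (_ \in _).
  have d0 : 0 < e / (c + L2norm psi + 1).
    by rewrite divr_gt0// ltr_wpDl// addr_ge0// L2norm_ge0.
  have [phi phiK vphi] := H _ d0.
  set d := e / _ in d0 phiK vphi.
  have -> : q = (v - phi) + (phi - K *: L2one) by rewrite /q addrA subrK.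
  rewrite L2ipDl.
  have h1 : L2ip a b (v - phi) psi <= d * L2norm psi.
    rewrite (le_trans (ler_norm _))// (le_trans (L2ip_CS _ _))//.
    by rewrite ler_wpM2r// L2norm_ge0.
  have h2 : L2ip a b (phi - K *: L2one) psi <= d * c.
    rewrite /c -L2ipZl; apply: L2ip_le; apply: aeW => x xab.
    rewrite [leRHS](_ : _ = d * L2one x * psi x)//.
    rewrite [leLHS](_ : _ = (phi x - K * L2one x) * psi x)//.
    rewrite L2oneE !mulr1 ler_wpM2r//; last first.
      by rewrite lerBlDl phiK.
    by rewrite psiE indicE; case: (_ \in _).
  rewrite (le_trans (lerD h1 h2))// -mulrDr.
  have -> : e = d * (c + L2norm psi + 1).
    by rewrite /d divfK// gt_eqF// ltr_wpDl// addr_ge0// L2norm_ge0.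
  by rewrite ler_wpM2l ?(ltW d0)// [leLHS]addrC lerDl.
have q00 : L2ip a b q psi = 0.
  by apply/eqP; rewrite eq_le q0/=; apply: Rintegral_ge0 => x _; exact: qpsi.
have iq := L2mul_integrable q psi.
have mq : measurable_fun setT (EFin \o (fun x => q x * psi x)).
  exact: (measurable_int _ iq).
have : (\int[mesU a b]_x `|(q x * psi x)%:E| = 0)%E.
  under eq_integral do rewrite gee0_abs ?lee_fin//.
  rewrite -[LHS]fineK; last exact: integrable_fin_num.
  by move: q00; rewrite L2ipE /Rintegral => ->.
move/(ae_eq_integral_abs _ measurableT mq) => ae0.
have {}ae0 : (fun x => q x * psi x) = (fun=> 0) %[ae mesU a b].
  by apply: ae_mono ae0 => x h /h[].
move/ae_eq_mesU : ae0; apply: ae_mono => x h /h/eqP.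
rewrite qE psiE indicE; have [|] := boolP (x \in A).
  rewrite inE/= /A/= => Kv; rewrite mulr1 subr_eq0 => /eqP.
  by move=> ->.
by rewrite notin_setE /A/= => /negP; rewrite -leNgt.
Qed.

End L2order.

(** * Test functions *)

Section test_functions.
Context {R : realType}.
Implicit Types (U : set R) (phi psi : R -> R).

Lemma derive1n_add n k phi : derive1n n (derive1n k phi) = derive1n (n + k) phi.
Proof. by rewrite /derive1n -iterD. Qed.

Lemma support_derive1 phi : closure [set x | derive1n 1 phi x != 0] `<=`
  closure [set x | phi x != 0].
Proof.
have cl : closed (closure [set x | phi x != 0]) by exact: closed_closure.
rewrite [X in _ `<=` X]((closure_id _).1 cl).
apply: closure_subset => x /=; apply: contra_neqP => xS.
rewrite derive1E (@near_eq_derive _ _ _ _ (cst 0)) ?derive_cst//.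
have nx : nbhs x (~` closure [set x | phi x != 0]).
  by apply: open_nbhs_nbhs; split=> //; exact: closed_openC.
apply: filterS nx => y yS; apply: contra_notP yS => /eqP py.
exact: subset_closure.
Qed.

Lemma support_derive1n k phi : closure [set x | derive1n k phi x != 0] `<=`
  closure [set x | phi x != 0].
Proof.
elim: k => // k IH; apply: subset_trans IH.
exact: (@support_derive1 (derive1n k phi)).
Qed.

Lemma test_function_derive1n U phi k : test_function U phi ->
  test_function U (derive1n k phi).
Proof.
move=> [dphi cphi sphi]; split.
- by move=> n x; rewrite derive1n_add.
- apply: (subclosed_compact _ cphi); first exact: closed_closure.
  exact: support_derive1n.
- by apply: subset_trans sphi; exact: support_derive1n.
Qed.

Lemma test_function_out U phi x : test_function U phi -> ~ U x -> phi x = 0.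
Proof.
move=> [_ _ sU] nUx; apply: contra_notP nUx => /eqP phix.
by apply/sU/subset_closure.
Qed.

Lemma derive1n_lin (c : R) phi psi n :
  (forall k x, derivable (derive1n k phi) x 1) ->
  (forall k x, derivable (derive1n k psi) x 1) ->
  derive1n n (c *: phi + psi) = c *: derive1n n phi + derive1n n psi.
Proof.
move=> dphi dpsi; elim: n => // n IH.
rewrite !derive1nS IH; apply/funext => x.
rewrite derive1E deriveD//; last exact: derivableZ.
by rewrite deriveZ//= !fctE !derive1E.
Qed.

Lemma test_function_lin U (c : R) phi psi : test_function U phi ->
  test_function U psi -> test_function U (c *: phi + psi).
Proof.
move=> [dphi cphi sphi] [dpsi cpsi spsi].
have sub : closure [set x | (c *: phi + psi) x != 0] `<=`
    closure [set x | phi x != 0] `|` closure [set x | psi x != 0].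
  rewrite -closureU; apply: closure_subset => x /=.
  have [p0|] := eqVneq (phi x) 0; last by left.
  have [q0|] := eqVneq (psi x) 0; last by right.
  rewrite [(_ + _) x](_ : _ = c * phi x + psi x)// p0 q0 mulr0 addr0 eqxx//.
split.
- move=> n x; rewrite derive1n_lin//; apply: derivableD => //.
  exact: derivableZ.
- apply: (subclosed_compact _ (compactU cphi cpsi)) => //.
  exact: closed_closure.
- by apply: subset_trans sub _ => x [/sphi|/spsi].
Qed.

Lemma test_function_LR (U : set R) phi a b : test_function U phi ->
  derivable_oo_LRcontinuous phi a b.
Proof.
move=> tphi; have cphi := test_function_continuous (k := 0) tphi.
have [dphi _ _] := tphi.
split; first by move=> x _; exact: (dphi 0%N).
- exact/cvg_at_right_filter/cphi.
- exact/cvg_at_left_filter/cphi.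
Qed.

Lemma test_function_within (U : set R) phi a b k : test_function U phi ->
  {within `[a, b], continuous (derive1n k phi)}.
Proof.
move=> tphi; apply: continuous_subspaceT; exact: (test_function_continuous tphi).
Qed.

Context {a b : R} (ab : a < b).
Local Notation mu := (@lebesgue_measure R).

Lemma continuous_integrable phi c d : {within `[c, d], continuous phi} ->
  mu.-integrable `[c, d] (EFin \o phi).
Proof.
move=> cphi; exact: (continuous_compact_integrable (@segment_compact _ c d) cphi).
Qed.

Lemma test_function_by_parts phi psi : test_function `]a, b[ phi ->
  test_function `]a, b[ psi ->
  L2ip a b phi (derive1n 1 psi) = - L2ip a b (derive1n 1 phi) psi.
Proof.
move=> tphi tpsi.
have cc f g : continuous f -> continuous g ->
    L2ip a b f g = \int[mu]_(x in `[a, b]) (f x * g x).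
  move=> cf cg; rewrite /L2ip.
  have i : mu.-integrable `[a, b] (EFin \o (fun x => f x * g x)).
    apply: continuous_integrable; apply: continuous_subspaceT => x.
    by apply: cvgM; [exact: cf|exact: cg].
  rewrite Rintegral_itv_obnd_cbnd ?Rintegral_itv_bndo_bndc//.
    apply: integrableS i => //; exact: subset_itv_co_cc.
  apply: integrableS i => //; exact: subset_itv_oo_cc.
have c0 := test_function_continuous (k := 0).
have c1 := test_function_continuous (k := 1).
rewrite (cc _ _ (c0 _ _ _ tphi) (c1 _ _ _ tpsi)).
rewrite (cc _ _ (c1 _ _ _ tphi) (c0 _ _ _ tpsi)).
rewrite (@Rintegration_by_parts _ phi psi (derive1n 1 phi) (derive1n 1 psi))//;
  do ?[exact: (test_function_within (k := 1) tphi)|exact: (test_function_within (k := 1) tpsi)|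
       exact: (test_function_LR _ _ tphi)|exact: (test_function_LR _ _ tpsi)].
have out x : x \notin `]a, b[ -> phi x = 0.
  by move=> xab; apply: (test_function_out tphi); exact/negP.
rewrite !out ?bound_itvE// ?in_itv/= ?ltxx ?andbF//.
by rewrite !mul0r subrr sub0r.
Qed.

(** [phi x] is the pairing of [phi'] with the indicator of [[a, x]], whose L2 norm is at most
    [Num.sqrt (b - a)]; Cauchy-Schwarz concludes. *)
Lemma test_function_bound phi (q : L2 a b) : test_function `]a, b[ phi ->
  q = derive1n 1 phi :> (R -> R) -> forall x, `|phi x| <= Num.sqrt (b - a) * L2norm q.
Proof.
move=> tphi qE x.
have [xab|xab] := boolP (x \in `]a, b[); last first.
  rewrite (test_function_out tphi); last exact/negP.
  by rewrite normr0 mulr_ge0// ?sqrtr_ge0 ?L2norm_ge0.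
have /andP[ax xb] : a < x < b by rewrite in_itv/= in xab.
have ftc : \int[mu]_(t in `[a, x]) derive1n 1 phi t = phi x.
  rewrite /Rintegral (@continuous_FTC2 _ _ phi)//=.
  - rewrite (test_function_out tphi (x := a)) ?subr0//.
    by rewrite /= in_itv/= ltxx.
  - exact: (test_function_within (k := 1) tphi).
  - exact: (test_function_LR _ _ tphi).
have [psi psiE] : exists w : L2 a b, w = \1_(`[a, x]%classic) :> (R -> R).
  apply: (bounded_L2 (K := 1)); first exact: measurable_indic.
  by apply: aeW => y _; rewrite indicE; case: (_ \in _); rewrite ?normr1 ?normr0.
have -> : phi x = L2ip a b q psi.
  have sub : `]a, b[ `&` `[a, x] = `]a, x]%classic.
    apply/seteqP; split=> y /=; rewrite !in_itv/=.
      by move=> [/andP[-> _] /andP[_ ->]].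
    by move=> /andP[ay yx]; rewrite ay yx (le_lt_trans yx xb) ltW.
  rewrite -ftc -Rintegral_itv_obnd_cbnd; last first.
    have i : mu.-integrable `[a, x] (EFin \o derive1n 1 phi).
      apply: continuous_integrable; exact: (test_function_within (k := 1) tphi).
    apply: integrableS i => //; exact: subset_itv_oc_cc.
  rewrite -sub Rintegral_mkcondr; apply: eq_Rintegral => y _.
  rewrite qE psiE patchE indicE; case: ifP => _; rewrite ?mulr1 ?mulr0//.
rewrite (le_trans (L2ip_CS _ _))// mulrC ler_wpM2r ?L2norm_ge0//.
rewrite -[leRHS]mul1r; apply: L2norm_le_bound => //.
by apply: aeW => y _; rewrite psiE indicE; case: (_ \in _); rewrite ?normr1 ?normr0.
Qed.

End test_functions.

(** * Sobolev spaces on an interval *)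

Section Sobolev.
Context {R : realType} {a b : R} (ab : a < b).
Implicit Types (g u v w : L2 a b).
Local Notation mu := (@lebesgue_measure R).

Lemma le_epsilon_mul (x y C : R) : 0 <= C ->
  (forall e, 0 < e -> x <= y + C * e) -> x <= y.
Proof.
move=> C0 h; apply/ler_addgt0Pr => e e0.
have C1 : 0 < C + 1 by rewrite ltr_wpDl.
apply: le_trans (h _ (divr_gt0 e0 C1)) _.
by rewrite lerD2l mulrA ler_pdivrMr// mulrC ler_wpM2l ?lerDl// ltW.
Qed.

Lemma L2ip_linl (c : R) u v (phi : R -> R) : test_function `]a, b[ phi ->
  L2ip a b (c *: u + v) phi = c * L2ip a b u phi + L2ip a b v phi.
Proof.
move=> tphi.
have [q qE] := @continuous_L2 R a b _ (test_function_continuous (k := 0) tphi).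
by rewrite -[phi]qE L2ipDl L2ipZl.
Qed.

Lemma test_L2 k (phi : R -> R) : test_function `]a, b[ phi ->
  exists q : L2 a b, q = derive1n k phi :> (R -> R).
Proof.
by move=> tphi; apply: continuous_L2; exact: (test_function_continuous tphi).
Qed.

Lemma weak_deriv_unique k u w w' : is_weak_deriv k u w ->
  is_weak_deriv k u w' -> w = w' %[ae mesU a b].
Proof.
move=> uw uw'; apply: ae_eq_of_test => phi tphi.
have := uw _ tphi; rewrite (uw' _ tphi).
by move/mulfI => -> //; rewrite expf_neq0// oppr_eq0 oner_eq0.
Qed.

Lemma is_weak_deriv_lin k (c : R) u v w w' : is_weak_deriv k u w ->
  is_weak_deriv k v w' -> is_weak_deriv k (c *: u + v) (c *: w + w').
Proof.
move=> uw vw phi tphi; rewrite L2ip_linl; last exact: test_function_derive1n.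
by rewrite L2ip_linl// uw// vw//; ring.
Qed.

Lemma is_weak_derivB k u v w w' : is_weak_deriv k u w ->
  is_weak_deriv k v w' -> is_weak_deriv k (u - v) (w - w').
Proof.
move=> uw vw; rewrite -(scaleN1r v) -(scaleN1r w') ![_ + -1 *: _]addrC.
exact: is_weak_deriv_lin.
Qed.

Lemma wderivP k u : (exists w, is_weak_deriv k u w) ->
  is_weak_deriv k u (wderiv k u).
Proof. by move=> [w uw]; rewrite /wderiv; apply: xgetPex; exists w. Qed.

Lemma Hk_wderivP n k u : Hk n u -> (k <= n)%N -> is_weak_deriv k u (wderiv k u).
Proof. by move=> uH kn; apply: wderivP; exact: uH. Qed.

(** This is how [wderiv] is computed throughout: exhibit some weak derivative and conclude by
    uniqueness almost everywhere. *)
Lemma wderiv_eq k u w : is_weak_deriv k u w -> wderiv k u = w %[ae mesU a b].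
Proof.
by move=> uw; apply: (weak_deriv_unique _ uw); apply: wderivP; exists w.
Qed.

Lemma Hk_lin n (c : R) u v : Hk n u -> Hk n v -> Hk n (c *: u + v).
Proof.
move=> uH vH j jn; have [w uw] := uH _ jn; have [w' vw] := vH _ jn.
by exists (c *: w + w'); exact: is_weak_deriv_lin.
Qed.

Lemma is_weak_deriv_test (phi q : L2 a b) : test_function `]a, b[ phi ->
  q = derive1n 1 phi :> (R -> R) -> is_weak_deriv 1 phi q.
Proof.
move=> tphi qE psi tpsi; rewrite qE expr1 mulN1r.
exact: test_function_by_parts.
Qed.

(** The definition of [H10] measures [wderiv 1 (v - phi)], a derivative chosen for the difference;
    by uniqueness it can be replaced by [wderiv 1 v] minus the classical derivative of [phi]. *)
Lemma H10_approx v : H10 v -> forall e, 0 < e -> exists phi q : L2 a b,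
  [/\ test_function `]a, b[ phi, q = derive1n 1 phi :> (R -> R),
      L2norm (v - phi) <= e & L2norm (wderiv 1 v - q) <= e].
Proof.
move=> [vH vd] e e0; have [phi tphi vphi] := vd _ e0.
have [q qE] := test_L2 1 tphi; exists phi, q; split=> //.
  apply: le_trans (ltW vphi).
  rewrite -[leLHS]ger0_norm ?L2norm_ge0// -sqrtr_sqr ler_wsqrtr//.
  by rewrite lerDl sqr_ge0.
have -> : L2norm (wderiv 1 v - q) = L2norm (wderiv 1 (v - phi)).
  apply/esym/L2norm_ae/wderiv_eq/is_weak_derivB; first exact: (Hk_wderivP vH).
  exact: is_weak_deriv_test.
apply: le_trans (ltW vphi).
rewrite -[leLHS]ger0_norm ?L2norm_ge0// -sqrtr_sqr ler_wsqrtr//.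
by rewrite lerDr sqr_ge0.
Qed.

Lemma H10_lin (c : R) u v : H10 u -> H10 v -> H10 (c *: u + v).
Proof.
move=> uH vH; split; first by apply: Hk_lin; [case: uH|case: vH].
move=> e e0.
(* The [H1norm] of the error will be at most [2 * (|c| + 1) * d]; having [|c| + 2] here makes this
   strictly less than [e]. *)
have d0 : 0 < e / (2 * (`|c| + 2)).
  by rewrite divr_gt0// mulr_gt0// ltr_wpDl.
set d := e / _ in d0.
have [phi [p [tphi pE h1 h2]]] := H10_approx uH d0.
have [psi [q [tpsi qE h3 h4]]] := H10_approx vH d0.
have tf : test_function `]a, b[ (c *: phi + psi : L2 a b).
  exact: test_function_lin.
exists (c *: phi + psi) => //.
have H1u := (uH.1 : Hk 1 u); have H1v := (vH.1 : Hk 1 v).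
have wp : is_weak_deriv 1 phi p by exact: is_weak_deriv_test.
have wq : is_weak_deriv 1 psi q by exact: is_weak_deriv_test.
have E x y z t : c *: x + y - (c *: z + t) = c *: (x - z) + (y - t) :> L2 a b.
  by rewrite scalerBr opprD addrACA.
have n1 : L2norm (c *: u + v - (c *: phi + psi)) <= (`|c| + 1) * d.
  rewrite E (le_trans (L2normD _ _))// L2normZ mulrDl mul1r lerD//.
  by rewrite ler_wpM2l.
have n2 : L2norm (wderiv 1 (c *: u + v - (c *: phi + psi))) <= (`|c| + 1) * d.
  rewrite (_ : L2norm _ = L2norm (c *: (wderiv 1 u - p) + (wderiv 1 v - q))).
    rewrite (le_trans (L2normD _ _))// L2normZ mulrDl mul1r lerD//.
    by rewrite ler_wpM2l.
  apply/L2norm_ae/wderiv_eq; rewrite -E.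
  by apply: is_weak_derivB; apply: is_weak_deriv_lin => //; apply: (Hk_wderivP (n := 1)).
have c1 : 0 <= (`|c| + 1) * d by rewrite mulr_ge0// ?addr_ge0// ltW.
have : H1norm (c *: u + v - (c *: phi + psi)) <= 2 * ((`|c| + 1) * d).
  have c2 : 0 <= 2 * ((`|c| + 1) * d) by rewrite mulr_ge0.
  rewrite /H1norm -(ger0_norm c2) -sqrtr_sqr ler_wsqrtr//.
  set y := (`|c| + 1) * d in c1 n1 n2 *.
  have n1' : L2norm (c *: u + v - (c *: phi + psi)) ^+ 2 <= y ^+ 2.
    by rewrite ler_pXn2r ?nnegrE ?L2norm_ge0.
  have n2' : L2norm (wderiv 1 (c *: u + v - (c *: phi + psi))) ^+ 2 <= y ^+ 2.
    by rewrite ler_pXn2r ?nnegrE ?L2norm_ge0.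
  apply: le_trans (lerD n1' n2') _.
  rewrite (_ : (2 * y) ^+ 2 = y ^+ 2 + y ^+ 2 + 2 * y ^+ 2); last by ring.
  by rewrite lerDl mulr_ge0// sqr_ge0.
move/le_lt_trans; apply.
have -> : e = 2 * (`|c| + 2) * d.
  by rewrite /d mulrC divfK// gt_eqF// mulr_gt0// ltr_wpDl.
by rewrite -mulrA ltr_pM2l// ltr_pM2r// ltrD2l ltr1n.
Qed.

(** Reduces stability under scaling to stability under [c *: u + v] with [v = u], so that membership
    of 0 need not be proved. *)
Lemma scaler_lin (c : R) u : c *: u = (c - 1) *: u + u.
Proof. by rewrite scalerBl scale1r subrK. Qed.

Lemma is_weak_derivZ k (c : R) u w : is_weak_deriv k u w ->
  is_weak_deriv k (c *: u) (c *: w).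
Proof.
by move=> uw; rewrite (scaler_lin c u) (scaler_lin c w); exact: is_weak_deriv_lin.
Qed.

Lemma H10Z (c : R) v : H10 v -> H10 (c *: v).
Proof. by move=> vH; rewrite scaler_lin; exact: H10_lin. Qed.

Lemma H2s_lin (c : R) u v : H2s u -> H2s v -> H2s (c *: u + v).
Proof. by move=> [u1 u2] [v1 v2]; split; [exact: H10_lin|exact: Hk_lin]. Qed.

Lemma H2sZ (c : R) v : H2s v -> H2s (c *: v).
Proof. by move=> vH; rewrite scaler_lin; exact: H2s_lin. Qed.

Lemma H2sB u v : H2s u -> H2s v -> H2s (u - v).
Proof. by move=> uH vH; rewrite -scaleN1r addrC; exact: H2s_lin. Qed.

Lemma wderivB n k u v : Hk n u -> Hk n v -> (k <= n)%N ->
  wderiv k (u - v) = wderiv k u - wderiv k v %[ae mesU a b].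
Proof.
by move=> uH vH kn; apply/wderiv_eq/is_weak_derivB; apply: (Hk_wderivP _ kn).
Qed.

Lemma H10_le v : H10 v -> {ae mu, forall x, `]a, b[%classic x ->
  v x <= Num.sqrt (b - a) * L2norm (wderiv 1 v)}.
Proof.
move=> vH; apply: ae_le_of_approx => e e0.
set c := Num.sqrt (b - a).
have c0 : 0 <= c by exact: sqrtr_ge0.
have d0 : 0 < e / (c + 1) by rewrite divr_gt0// ltr_wpDl.
have [phi [q [tphi qE h1 h2]]] := H10_approx vH d0.
exists phi => [x xab|]; last first.
  by rewrite (le_trans h1)// ler_pdivrMr ?ltr_wpDl// ler_peMr ?lerDr// ltW.
rewrite (le_trans (ler_norm _))// (le_trans (test_function_bound ab tphi qE x))//.
have : L2norm q <= L2norm (wderiv 1 v) + e / (c + 1).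
  rewrite -[q](subKr (wderiv 1 v)) (le_trans (L2normB _ _))// lerD2l//.
move=> /(ler_wpM2l c0) /le_trans; apply.
rewrite mulrDr lerD2l mulrA ler_pdivrMr ?ltr_wpDl// mulrC ler_wpM2l ?lerDl//.
exact: ltW.
Qed.

Lemma H10_bound v : H10 v -> {ae mu, forall x, `]a, b[%classic x ->
  `|v x| <= Num.sqrt (b - a) * L2norm (wderiv 1 v)}.
Proof.
move=> vH; have h1 := H10_le vH.
have H0 : H10 (- v) by rewrite -scaleN1r; exact: H10Z.
have nv : L2norm (wderiv 1 (- v)) = L2norm (wderiv 1 v).
  rewrite -[RHS]L2normN; apply/L2norm_ae/wderiv_eq => phi tphi.
  have [q qE] := test_L2 1 tphi; have [p pE] := test_L2 0 tphi.
  have := Hk_wderivP vH.1 (leqnn 1) tphi.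
  by rewrite -qE -[phi]pE !L2ipNl => ->; rewrite mulrN.
have h2 := H10_le H0; rewrite nv in h2.
apply: ae_mono (ae_and h1 h2) => x [h3 h4] xab.
by rewrite ler_norml h3// andbT lerNl h4.
Qed.

Lemma H10_Poincare v : H10 v -> L2norm v <= (b - a) * L2norm (wderiv 1 v).
Proof.
move=> vH; apply: le_trans (L2norm_le_bound ab (H10_bound vH) _) _.
  by rewrite mulr_ge0 ?sqrtr_ge0 ?L2norm_ge0.
by rewrite mulrAC -expr2 sqr_sqrtr// subr_ge0 ltW.
Qed.

(** Boundary values enter through [v], approximated by test functions [phi]. For these, [(g, phi'')]
    is computed in two ways: with the first derivative of [g] tested on [phi'], and with the second
    tested on [phi]. *)
Lemma weak_by_parts g v : Hk 2 g -> H10 v ->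
  L2ip a b (wderiv 1 g) (wderiv 1 v) = - L2ip a b (wderiv 2 g) v.
Proof.
move=> gH vH; apply/eqP; rewrite -subr_eq0 opprK -normr_le0.
apply: (@le_epsilon_mul _ _ (L2norm (wderiv 1 g) + L2norm (wderiv 2 g))).
  by rewrite addr_ge0 ?L2norm_ge0.
move=> e e0; rewrite add0r.
have [phi [q [tphi qE h1 h2]]] := H10_approx vH e0.
have D1 := Hk_wderivP gH (isT : (1 <= 2)%N) (test_function_derive1n 1 tphi).
have D2 := Hk_wderivP gH (leqnn 2) tphi.
rewrite derive1n_add D2 -qE in D1.
have {D1 D2} D : L2ip a b (wderiv 1 g) q = - L2ip a b (wderiv 2 g) phi.
  by move: D1; rewrite expr1 sqrrN expr1n mul1r mulN1r => ->; rewrite opprK.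
have -> : L2ip a b (wderiv 1 g) (wderiv 1 v) + L2ip a b (wderiv 2 g) v =
  L2ip a b (wderiv 1 g) (wderiv 1 v - q) + L2ip a b (wderiv 2 g) (v - phi).
  by rewrite !L2ipBr D; ring.
rewrite (le_trans (ler_normD _ _))// mulrDl lerD//;
  by rewrite (le_trans (L2ip_CS _ _))// ler_wpM2l ?L2norm_ge0.
Qed.

Lemma H2s_norm_ge0 v : 0 <= H2s_norm v.
Proof. exact: sqrtr_ge0. Qed.

Lemma H2s_normE v : H2s_norm v = L2norm (wderiv 2 v).
Proof. by rewrite L2normE. Qed.

Lemma H4s_normE v : H4s_norm v = L2norm (wderiv 4 v).
Proof. by rewrite L2normE. Qed.

(** [v_x] need not vanish at the endpoints, so [H10_Poincare] is not applied to it. Instead [|v_x|^2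
    = - (v_xx, v) <= |v_xx| * (b - a) * |v_x|], and one factor [|v_x|] is cancelled. *)
Lemma H2s_wderiv1_le v : H2s v ->
  L2norm (wderiv 1 v) <= (b - a) * H2s_norm v.
Proof.
move=> [v1 v2]; have [->|n0] := eqVneq (L2norm (wderiv 1 v)) 0.
  by rewrite mulr_ge0 ?subr_ge0 ?H2s_norm_ge0// ltW.
have np : 0 < L2norm (wderiv 1 v) by rewrite lt_neqAle eq_sym n0 L2norm_ge0.
rewrite -(ler_pM2r np) -expr2 L2norm_sqr weak_by_parts//.
rewrite (le_trans (ler_norm _))// normrN (le_trans (L2ip_CS _ _))// -H2s_normE.
rewrite mulrAC [leRHS]mulrC ler_wpM2l ?H2s_norm_ge0//.
exact: H10_Poincare.
Qed.

Lemma H2s_sup_bound v : H2s v -> {ae mu, forall x, `]a, b[%classic x ->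
  `|v x| <= Num.sqrt (b - a) * (b - a) * H2s_norm v}.
Proof.
move=> vH; apply: ae_mono (H10_bound vH.1) => x h xab.
by rewrite (le_trans (h xab))// -mulrA ler_wpM2l ?sqrtr_ge0// H2s_wderiv1_le.
Qed.

Lemma H2s_Poincare v : H2s v -> L2norm v <= (b - a) ^+ 2 * H2s_norm v.
Proof.
move=> vH; rewrite (le_trans (H10_Poincare vH.1))// expr2 -mulrA.
by rewrite ler_wpM2l ?H2s_wderiv1_le// subr_ge0 ltW.
Qed.

Lemma H2s_by_parts g v : H2s g -> H2s v ->
  L2ip a b (wderiv 2 g) v = L2ip a b g (wderiv 2 v).
Proof.
move=> [g1 g2] [v1 v2]; apply: oppr_inj.
have h1 := weak_by_parts g2 v1; have h2 := weak_by_parts v2 g1.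
by rewrite -h1 (L2ipC (wderiv 1 g)) h2 (L2ipC (wderiv 2 v)).
Qed.

(** The conditions on [u_xx] at the endpoints are carried by [H2s (wderiv 2 u)]; writing the fourth
    derivative through [wderiv 2 u] lets integration by parts use them. *)
Lemma wderiv4 u : H4s u -> wderiv 4 u = wderiv 2 (wderiv 2 u) %[ae mesU a b].
Proof.
move=> [u4 _ [_ w2]]; apply: wderiv_eq => phi tphi.
have D1 := Hk_wderivP u4 (isT : (2 <= 4)%N) (test_function_derive1n 2 tphi).
have D2 := Hk_wderivP w2 (leqnn 2) tphi.
by rewrite derive1n_add in D1; rewrite D1 D2 mulrA -exprD.
Qed.

Lemma H4s_by_parts u v : H4s u -> H2s v ->
  L2ip a b (wderiv 4 u) v = L2ip a b (wderiv 2 u) (wderiv 2 v).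
Proof.
move=> uH vH; rewrite (L2ip_ae _ (wderiv4 uH)); apply: H2s_by_parts => //.
by case: uH.
Qed.

End Sobolev.

(** * Real functions of time *)

Section real_lemmas.
Context {R : realType}.
Local Notation mu := (@lebesgue_measure R).

(** Only [y] is confined to the segment; [z] is any point close to it, since a perturbed function
    may leave the range of its limit. Compactness in its covering form, over radii tending to 0 from
    the right, makes the local moduli of continuity uniform. *)
Lemma segment_unif_continuous (F : R -> R) (K e : R) : continuous F -> 0 < e ->
  exists2 d : R, 0 < d & forall y z, `|y| <= K -> `|y - z| <= d -> `|F y - F z| <= e.
Proof.
move=> cF e0.
have /compact_near_coveringP : compact `[- K, K]%classic by exact: segment_compact.
move=> /(_ _ (0 : R)^'+ (fun d y => forall z, `|y - z| <= d -> `|F y - F z| <= e) _).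
case.
  move=> x _.
  have e20 : 0 < e / 2 by rewrite divr_gt0.
  have /cvgrPdist_le/(_ _ e20)/nbhs_ballP[r /= r0 Hr] := cF x.
  have r20 : 0 < r / 2 by rewrite divr_gt0.
  exists (ball x (r / 2), [set d | d < r / 2]) => [|[y d] [/= xy dr] z yz].
    split; first exact: nbhsx_ballx.
    exact: nbhs_right_lt.
  have xz : `|x - z| < r.
    rewrite -(subrK y x) -addrA (le_lt_trans (ler_normD _ _))// [ltRHS]splitr.
    by rewrite ltrD// (le_lt_trans yz).
  rewrite -(subrK (F x) (F y)) -addrA (le_trans (ler_normD _ _))// [leRHS]splitr.
  rewrite lerD//; last exact: Hr.
  rewrite distrC; apply: Hr; apply: lt_trans xy _.
  by rewrite ltr_pdivrMr// ltr_pMr// ltr1n.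
move=> d /= d0 Hd; exists (d / 2); first by rewrite divr_gt0.
move=> y z yK; apply: Hd => //=.
- rewrite sub0r normrN gtr0_norm ?divr_gt0// ltr_pdivrMr// ltr_pMr// ltr1n//.
- by rewrite divr_gt0.
- by rewrite in_itv/= -ler_norml.
Qed.

(** Integrating factor: [V t * expR (c * t)] is nonincreasing. Derivatives are available for [t > 0]
    only, hence the separate right continuity at 0. The case [c = 0] serves to bound the energy by
    its initial value. *)
Lemma gronwall_le (V dV : R -> R) (c : R) :
  (forall t : R, 0 < t -> is_derive t 1 V (dV t)) -> V x @[x --> (0 : R)^'+] --> V 0 ->
  (forall t : R, 0 < t -> dV t <= - c * V t) ->
  forall t : R, 0 <= t -> V t <= V 0 * expR (- (c * t)).
Proof.
move=> DV V0 le_dV t t0.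
pose W : R -> R := V * (expR \o (c \*: id)).
have DW (x : R) : 0 < x -> is_derive x 1 W (expR (c * x) * (dV x + c * V x)).
  move=> x0; have := DV _ x0 => DVx.
  have Dc : is_derive x (1 : R) (c \*: id) (c *: 1) by exact: is_deriveZ.
  apply: is_derive_eq; rewrite /GRing.scale/=; ring.
have cW : {within `[0, +oo[, continuous W}.
  apply/continuous_within_itvcyP; split.
    move=> x; rewrite in_itv/= andbT => /DW[dW _].
    have /derivable1_diffP/differentiable_continuous h := dW.
    exact: h.
  apply: cvgM => //; apply: cvg_at_right_filter; apply: continuous_comp.
    by apply: cvgMr; exact: cvg_id.
  exact: continuous_expR.
have le_W : W t <= W 0.
  apply: (ler0_derive1_nincry _ _ cW) => // x; rewrite in_itv/= andbT => x0.
    by have [] := DW _ x0.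
  have DWx := DW _ x0; rewrite derive1E derive_val.
  rewrite pmulr_rle0 ?expR_gt0//.
  by have := le_dV _ x0; rewrite mulNr; lra.
move: le_W; rewrite [W 0](_ : _ = V 0 * expR (c * 0))// mulr0 expR0 mulr1.
rewrite [W t](_ : _ = V t * expR (c * t))// => le_W.
by rewrite expRN ler_pdivlMr ?expR_gt0.
Qed.

(** A positive value would persist on an interval around [t0]; a bump on that interval gives a
    positive integrand with zero integral, so the interval would be null. *)
Lemma eq0_of_test_ge0 (h : R -> R) (t0 : R) : 0 < t0 ->
  (forall t : R, 0 < t -> {for t, continuous h}) ->
  (forall phi, test_function `]0, +oo[ phi ->
    \int[mu]_(t in `]0, +oo[) (h t * phi t) = 0) -> h t0 <= 0.
Proof.
move=> t00 ch hphi; rewrite leNgt; apply/negP => ht0.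
have [r r0 Hr] : exists2 r, 0 < r &
    forall t, t \in `[t0 - r, t0 + r] -> 0 < t /\ 0 < h t.
  have n1 : \forall t \near t0, 0 < t /\ 0 < h t.
    near=> t; split; near: t; first exact: lt_nbhsr.
    have := ch _ t00; move/cvgr_gt; exact.
  have /nbhs_ballP[r /= r0 Hr] := n1.
  exists (r / 2); first by rewrite divr_gt0.
  move=> t tr; apply: Hr; rewrite /ball/= ltr_norml.
  move: tr; rewrite in_itv/=; lra.
pose c := t0 - r; pose d := t0 + r.
have cd : c < d by rewrite /c /d; lra.
have sub : `[c, d]%classic `<=` `]0, +oo[%classic.
  by move=> t /= /Hr[tp _]; rewrite in_itv/= tp.
pose g t := h t * bump c d 1 t.
have g0 t : t \in `]c, d[ -> 0 < g t.
  move=> tcd; rewrite mulr_gt0 ?bump_gt0//.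
  by have [] := Hr _ (subset_itv_oo_cc tcd).
have gout t : t \notin `]c, d[ -> g t = 0.
  by move=> tcd; rewrite /g bump_out ?mulr0// ltW.
have cg : {within `[c, d], continuous g}.
  apply/continuous_in_subspaceT => t; rewrite inE/= => tcd; apply: cvgM.
    by apply: ch; case: (Hr _ tcd).
  have /derivable1_diffP/differentiable_continuous := @bump_smooth R c d 1 0 t.
  by move=> k; exact: k.
have ig : mu.-integrable `]c, d[ (EFin \o g).
  apply: integrableS (continuous_integrable cg) => //; exact: subset_itv_oo_cc.
have int0 : \int[mu]_(t in `]c, d[) g t = 0.
  have tb : test_function `]0, +oo[ (bump c d 1) by apply: bump_test => //; exact: ltW.
  rewrite -(hphi _ tb).
  have -> : `]c, d[%classic = `]0, +oo[%classic `&` `]c, d[%classic.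
    rewrite setIidr//; apply: subset_trans sub; exact: subset_itv_oo_cc.
  rewrite Rintegral_mkcondr; apply: eq_Rintegral => t _.
  rewrite patchE; case: ifPn => //; rewrite notin_setE/= => /negP tcd.
  by rewrite -/(g t) gout.
have mg := measurable_int _ ig.
have : (\int[mu]_(t in `]c, d[) `|(g t)%:E| = 0)%E.
  rewrite -[RHS]/((0 : R)%:E) -int0 /Rintegral fineK; last exact: integrable_fin_num.
  apply: eq_integral => t; rewrite inE/= => tcd.
  by rewrite /= gtr0_norm// g0.
have mcd : measurable `]c, d[%classic by [].
move/(ae_eq_integral_abs mu mcd mg) => [N [mN N0 sN]].
have : (mu `]c, d[ <= 0)%E.
  rewrite -N0; apply: le_measure; rewrite ?inE//.
  move=> t tcd; apply: sN => /= /(_ tcd) [] gt0.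
  by have := g0 _ tcd; rewrite gt0 ltxx.
have /= -> := @lebesgue_measure_itv R `]c, d[.
by rewrite lte_fin cd -EFinD lee_fin; move: cd; lra.
Unshelve. all: by end_near. Qed.

Lemma eq0_of_test (h : R -> R) :
  (forall t : R, 0 < t -> {for t, continuous h}) ->
  (forall phi, test_function `]0, +oo[ phi ->
    \int[mu]_(t in `]0, +oo[) (h t * phi t) = 0) ->
  forall t, 0 < t -> h t = 0.
Proof.
move=> ch hphi t t0; apply/eqP; rewrite eq_le (eq0_of_test_ge0 t0)//=.
rewrite -oppr_le0; apply: (eq0_of_test_ge0 (h := fun x => - h x) t0) => [s s0|].
  by apply: cvgN; exact: ch.
(* The test function [- phi] is written [- 2 *: phi + phi], the form covered by
   [test_function_lin]. *)
move=> phi tphi; apply: etrans (hphi _ (test_function_lin (- 2) tphi tphi)).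
apply: eq_Rintegral => s _.
rewrite [((_ *: _) + _) s](_ : _ = - 2 * phi s + phi s)//; ring.
Qed.

(** [h] may be singular at 0, but the support of [phi] is a compact subset of []0, +oo[], on which
    the product is continuous. *)
Lemma test_mul_integrable (h phi : R -> R) :
  (forall t : R, 0 < t -> {for t, continuous h}) ->
  test_function `]0, +oo[ phi ->
  mu.-integrable `]0, +oo[ (EFin \o (fun t => h t * phi t)).
Proof.
move=> ch tphi; have [_ + sU] := tphi.
set S := closure _ in sU * => cS.
have ig : mu.-integrable S (EFin \o (fun t => h t * phi t)).
  apply: continuous_compact_integrable => //.
  apply/continuous_in_subspaceT => t; rewrite inE => /sU; rewrite /= in_itv/= andbT => t0.
  apply: cvgM; first exact: ch.
  exact: (test_function_continuous (k := 0) tphi).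
have mS : measurable S by apply: closed_measurable; exact: closed_closure.
have : mu.-integrable `]0, +oo[ ((EFin \o (fun t => h t * phi t)) \_ S).
  by apply/integrable_restrict => //; rewrite setIidr.
apply: eq_integrable => // t _; rewrite patchE; case: ifPn => //.
rewrite notin_setE => nS /=; suff -> : phi t = 0 by rewrite mulr0.
by apply: contra_notP nS => /eqP phit; exact: subset_closure.
Qed.

End real_lemmas.

(** * Differentiation of L2-valued functions *)

Section L2_valued.
Context {R : realType} {a b : R}.
Implicit Types (p q u v : R -> L2 a b) (t : R).
Local Notation ge0_dnbhs t := (within [set s : R | 0 <= s] (dnbhs t)).
Local Notation ge0_nbhs t := (within [set s : R | 0 <= s] (nbhs t)).

Lemma ge0_dnbhs_proper t : 0 <= t -> ProperFilter (ge0_dnbhs t).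
Proof.
move=> t0; split; last exact: within_filter.
move=> /nbhs_ballP[e /= e0 /(_ (t + e / 2))]; apply => /=.
- rewrite /ball/= opprD addNKr normrN gtr0_norm ?divr_gt0//.
  by rewrite ltr_pdivrMr// ltr_pMr// ltr1n.
- by rewrite gt_eqF// ltrDl divr_gt0.
- by rewrite addr_ge0// divr_ge0// ltW.
Qed.

Lemma ge0_nbhs_gt0 t : 0 < t -> ge0_nbhs t = nbhs t.
Proof.
move=> t0; apply: within_interior; rewrite /interior/=.
near=> s; apply: ltW; near: s; exact: lt_nbhsr.
Unshelve. all: by end_near. Qed.

Lemma ge0_dnbhs_gt0 t : 0 < t -> ge0_dnbhs t = dnbhs t.
Proof.
move=> t0; apply/seteqP; split => A.
  move=> h; have n0 : \forall s \near dnbhs t, 0 <= s.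
    apply: nbhs_dnbhs; near=> s; apply: ltW; near: s; exact: lt_nbhsr.
  apply: (@filterS2 _ (dnbhs t) _ _ _ A _ n0 h) => s s0 hs; exact: hs.
by apply: filterS => s.
Unshelve. all: by end_near. Qed.

Lemma cvg_near_eq {T} (F : set_system T) {FF : Filter F} (f g : T -> R) (l : R) :
  (\forall s \near F, f s = g s) -> g @ F --> l -> f @ F --> l.
Proof.
move=> fg; apply: cvg_trans.
exact: near_eq_cvg (filterS (fun s => @esym _ _ _) fg).
Qed.

Lemma cvg0_le {T} (F : set_system T) {FF : Filter F} (f g : T -> R) (C : R) :
  (\forall s \near F, 0 <= f s <= C * g s) -> g @ F --> (0 : R) ->
  f @ F --> (0 : R).
Proof.
move=> fg g0; apply: (squeeze_cvgr fg); first exact: cvg_cst.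
by rewrite -(mulr0 C); apply: cvgMr.
Qed.

Lemma L2ip_cvg {T} (F : set_system T) {FF : Filter F} (p q : T -> L2 a b)
    (P Q : L2 a b) :
  L2norm (p s - P) @[s --> F] --> (0 : R) ->
  L2norm (q s - Q) @[s --> F] --> (0 : R) ->
  L2ip a b (p s) (q s) @[s --> F] --> L2ip a b P Q.
Proof.
move=> pP qQ.
suff h : `|L2ip a b (p s) (q s) - L2ip a b P Q| @[s --> F] --> (0 : R).
  exact: (subr_cvg0 _ _).1 (norm_cvg0 h).
pose g s := L2norm (p s - P) * (L2norm (q s - Q) + L2norm Q)
  + L2norm P * L2norm (q s - Q).
apply: (@cvg0_le _ _ FF _ g 1); last first.
  rewrite [X in _ --> X](_ : _ = 0 * (0 + L2norm Q) + L2norm P * 0); last by ring.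
  apply: cvgD; last by apply: cvgMr.
  by apply: cvgM => //; apply: cvgD => //; exact: cvg_cst.
apply: nearW => s; rewrite normr_ge0 mul1r.
have -> : L2ip a b (p s) (q s) - L2ip a b P Q =
    L2ip a b (p s - P) (q s) + L2ip a b P (q s - Q).
  by rewrite L2ipBl L2ipBr; ring.
rewrite (le_trans (ler_normD _ _))// lerD// (le_trans (L2ip_CS _ _))//.
by rewrite ler_wpM2l ?L2norm_ge0// -[q s in leLHS](subrK Q) L2normD.
Qed.

Lemma time_deriv_unique u t (w w' : L2 a b) : 0 <= t ->
  is_time_deriv_at L2norm u t w -> is_time_deriv_at L2norm u t w' ->
  w = w' %[ae mesU a b].
Proof.
move=> t0 h h'; apply/L2sub_eq0.
have FF := ge0_dnbhs_proper t0.
have h0 : L2norm (w - w') @[s --> ge0_dnbhs t] --> (0 : R).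
  pose D s := (s - t)^-1 *: (u s - u t).
  have hh : L2norm (D s - w) + L2norm (D s - w') @[s --> ge0_dnbhs t] --> (0 : R).
    by rewrite -[X in _ --> X]addr0; exact: cvgD.
  apply: (cvg0_le (C := 1) _ hh); apply: nearW => s; rewrite L2norm_ge0/=.
  rewrite mul1r -(L2normN (_ - w)) (le_trans _ (L2normD _ _))// opprB.
  by rewrite addrA subrK.
exact: (cvg_unique _ (cvg_cst (L2norm (w - w'))) h0).
Qed.

Lemma is_time_deriv_ae u v t (w w' : L2 a b) : 0 <= t ->
  (forall s, 0 <= s -> u s = v s %[ae mesU a b]) -> w = w' %[ae mesU a b] ->
  is_time_deriv_at L2norm u t w -> is_time_deriv_at L2norm v t w'.
Proof.
move=> t0 uv ww'; apply: cvg_trans; apply: near_eq_cvg.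
near=> s.
have s0 : 0 <= s by near: s; exact: withinT.
apply: L2norm_ae; apply: ae_mono (ae_and (uv _ s0) (ae_and (uv _ t0) ww')).
move=> x [e1 [e2 e3]] _.
transitivity ((s - t)^-1 * (v s x - v t x) - w' x) => //.
by rewrite -e1// -e2// -e3.
Unshelve. all: by end_near. Qed.

Lemma dt_ae u t (w : L2 a b) : 0 <= t -> is_time_deriv_at L2norm u t w ->
  dt u t = w %[ae mesU a b].
Proof.
move=> t0 uw; apply: (time_deriv_unique t0 _ uw).
by rewrite /dt; apply: xgetPex; exists w.
Qed.

(** The filter is arbitrary so that the lemma serves both for punctured neighbourhoods of [t > 0]
    and for right neighbourhoods of 0. *)
Lemma time_deriv_cvg u t (w : L2 a b) (F : set_system R) {FF : Filter F} :
  s @[s --> F] --> t ->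
  L2norm ((s - t)^-1 *: (u s - u t) - w) @[s --> F] --> (0 : R) ->
  L2norm (u s - u t) @[s --> F] --> (0 : R).
Proof.
move=> Ft uw.
have Ft0 : `|s - t| @[s --> F] --> (0 : R).
  by rewrite -(normr0 R) -(subrr t); apply: cvg_norm; apply: cvgB => //; exact: cvg_cst.
pose g s := `|s - t| * (L2norm ((s - t)^-1 *: (u s - u t) - w) + L2norm w).
apply: (@cvg0_le _ _ FF _ g 1); last first.
  rewrite -(mul0r (0 + L2norm w)); apply: cvgM => //; apply: cvgD => //.
  exact: cvg_cst.
apply: nearW => s; rewrite L2norm_ge0 mul1r/=.
have [->|st] := eqVneq s t.
  by rewrite (L2sub_eq0 _ _).2 ?mulr_ge0 ?addr_ge0 ?L2norm_ge0//; exact: aeW.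
have {1}-> : u s - u t = (s - t) *: ((s - t)^-1 *: (u s - u t)).
  by rewrite scalerA mulfV ?scale1r// subr_eq0.
rewrite L2normZ ler_wpM2l// -[X in L2norm X](subrK w).
exact: L2normD.
Qed.

(** The difference quotient splits as [(Dp, q s) + (p t, Dq)], where [Dp] and [Dq] are the quotients
    of [p] and [q]; joint continuity of the pairing gives the limit, which [g] takes as its value at
    [t]. *)
Lemma is_derive_L2ip p q t (P Q : L2 a b) : 0 < t ->
  is_time_deriv_at L2norm p t P -> is_time_deriv_at L2norm q t Q ->
  is_derive t 1 (fun s => L2ip a b (p s) (q s))
    (L2ip a b P (q t) + L2ip a b (p t) Q).
Proof.
move=> t0; rewrite /is_time_deriv_at ge0_dnbhs_gt0// => pP qQ.
have qc : L2norm (q s - q t) @[s --> t^'] --> (0 : R).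
  apply: time_deriv_cvg qQ; exact: nbhs_dnbhs.
have pc : L2norm (p t - p t) @[s --> t^'] --> (0 : R).
  by rewrite (L2sub_eq0 _ _).2; [exact: cvg_cst|exact: aeW].
apply/is_derive1_caratheodory.
pose g s := if s == t then L2ip a b P (q t) + L2ip a b (p t) Q else
  (s - t)^-1 * (L2ip a b (p s) (q s) - L2ip a b (p t) (q t)).
exists g; split.
- move=> s; rewrite /g; case: eqVneq => [->|st]; first by rewrite !subrr mulr0.
  by rewrite mulrC mulrA mulfV ?mul1r// subr_eq0.
- apply/continuous_withinNx; rewrite /g eqxx.
  apply: cvg_trans (cvgD (L2ip_cvg pP qc) (L2ip_cvg pc qQ)).
  apply: near_eq_cvg; near=> s.
  rewrite ifF; last by apply/negbTE; near: s; exact: nbhs_dnbhs_neq.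
  transitivity (L2ip a b ((s - t)^-1 *: (p s - p t)) (q s)
    + L2ip a b (p t) ((s - t)^-1 *: (q s - q t))) => //.
  by rewrite L2ipZl L2ipZr -mulrDr L2ipBl L2ipBr; congr (_ * _); ring.
- by rewrite /g eqxx.
Unshelve. all: by end_near. Qed.

End L2_valued.

(** * The Lyapunov functional *)

Section lyapunov.
Context {R : realType}.

(** In the application [X = |w'|^2], [Y = |w_xx|^2], [Z = (w', w)], [g = (F(w'), w')] and
    [h = (F(w'), w)]. The bound on [h] is asked only while [Y] is below the initial energy, because
    [K] comes from a sup bound on [w]. *)
Lemma lyapunov_decay (X Y Z g h : R -> R) (al C0 K : R) :
  0 < al -> 0 <= C0 -> 0 <= K ->
  (forall t, 0 <= t -> [/\ 0 <= X t, 0 <= Y t & `|Z t| <= C0 * (X t + Y t)]) ->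
  X t @[t --> (0 : R)^'+] --> X 0 -> Y t @[t --> (0 : R)^'+] --> Y 0 ->
  Z t @[t --> (0 : R)^'+] --> Z 0 ->
  (forall t : R, 0 < t -> is_derive t 1 (X + Y) (- 2 * g t)) ->
  (forall t : R, 0 < t -> is_derive t 1 Z (X t - Y t - h t)) ->
  (forall t, 0 < t -> al * X t <= g t) ->
  (forall M t, 1 <= M -> 0 < t -> Y t <= X 0 + Y 0 ->
     `|h t| <= M * g t + K / M * Y t) ->
  exponential_decay (X + Y).
Proof.
move=> al0 C00 K0 XYZ cX cY cZ dE dZ gX hM.
have cE : (X + Y) t @[t --> (0 : R)^'+] --> (X + Y) 0 by exact: cvgD.
have le_E t : 0 < t -> X t + Y t <= X 0 + Y 0.
  move=> t0; have := gronwall_le (c := 0) dE cE _ (ltW t0).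
  rewrite mul0r oppr0 expR0 mulr1; apply => s s0.
  have [X0 _ _] := XYZ _ (ltW s0).
  rewrite mul0r mulNr oppr_le0 mulr_ge0// (le_trans _ (gX _ s0))//.
  by rewrite mulr_ge0// ltW.
(* This makes [K / M <= 1 / 2], so the cross term consumes at most half of the [- Y] in the
   derivative of [Z]. *)
pose M := 1 + 2 * K.
have M1 : 1 <= M by rewrite lerDl mulr_ge0.
have M0 : 0 < M by rewrite (lt_le_trans ltr01).
have KM : K / M <= 1 / 2 by rewrite ler_pdivrMr// /M; lra.
(* The three bounds respectively absorb [M * g] into the dissipation, absorb [X] into [g] through
   [al * X <= g], and keep [V] comparable to [X + Y]. *)
pose ep := Num.min (Num.min (1 / (2 * M)) (al / 3)) (1 / (4 * (C0 + 1))).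
have ep0 : 0 < ep.
  by rewrite !lt_min !divr_gt0//= ?mulr_gt0// ltr_wpDl.
have epM : ep * M <= 1 / 2.
  have : ep <= 1 / (2 * M) by rewrite !ge_min lexx.
  rewrite -ler_pdivlMr//; congr (_ <= _); by rewrite invfM mulrA.
have epa : 3 * ep <= al.
  have : ep <= al / 3 by rewrite !ge_min lexx orbT.
  by rewrite ler_pdivlMr// mulrC.
have epC : ep * (4 * (C0 + 1)) <= 1.
  have : ep <= 1 / (4 * (C0 + 1)) by rewrite !ge_min lexx !orbT.
  by rewrite ler_pdivlMr// mulr_gt0// ltr_wpDl.
pose V : R -> R := (X + Y) + (2 * ep) \*: Z.
pose dV t := - 2 * g t + (2 * ep) *: (X t - Y t - h t).
have VE t : V t = X t + Y t + 2 * ep * Z t by [].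
have V_bd t : 0 <= t -> (X t + Y t) / 2 <= V t <= 3 / 2 * (X t + Y t).
  move=> t0; have [X0 Y0 Zt] := XYZ _ t0.
  have E0 : 0 <= X t + Y t by rewrite addr_ge0.
  have : `|2 * ep * Z t| <= (X t + Y t) / 2.
    rewrite normrM gtr0_norm ?mulr_gt0//.
    apply: le_trans (ler_wpM2l _ Zt) _; first by rewrite mulr_ge0// ltW.
    rewrite mulrA [leRHS]mulrC ler_wpM2r//.
    by have := ltW ep0; lra.
  by rewrite VE ler_norml => /andP[h1 h2]; apply/andP; split; lra.
have dVle t : 0 < t -> dV t <= - (2 / 3 * ep) * V t.
  move=> t0; have [X0 Y0 Zt] := XYZ _ (ltW t0).
  have /andP[_ V2] := V_bd _ (ltW t0).
  have gt0 : 0 <= g t by rewrite (le_trans _ (gX _ t0))// mulr_ge0// ltW.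
  have Yt : Y t <= X 0 + Y 0 by rewrite (le_trans _ (le_E _ t0))// lerDr.
  have ht := hM _ _ M1 t0 Yt.
  have ht' : - h t <= M * g t + Y t / 2.
    rewrite (le_trans (ler_norm _))// normrN (le_trans ht)// lerD2l.
    by have := ler_wpM2r Y0 KM; lra.
  (* From [2 ep M g <= g] and [3 ep X <= g] one gets [dV <= - g + 2 ep X - ep Y <= - ep (X + Y)];
     the factor [2 / 3] then comes from [V <= 3 / 2 (X + Y)]. *)
  apply: (@le_trans _ _ (- ep * (X t + Y t))); last first.
    rewrite !mulNr lerN2; have := ler_wpM2l (ltW ep0) V2; lra.
  rewrite /dV /GRing.scale/=.
  have h1 : ep * - h t <= ep * (M * g t + Y t / 2) by rewrite ler_wpM2l// ltW.
  have h2 : (ep * M) * g t <= 1 / 2 * g t by rewrite ler_wpM2r.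
  have h3 : 3 * ep * X t <= g t.
    by rewrite (le_trans _ (gX _ t0))// ler_wpM2r.
  move: h1 h2 h3; clearbody ep M; clear.
  lra.
have V00 : 0 <= V 0.
  have [X0 Y0 _] := XYZ _ (lexx 0).
  have /andP[V1 _] := V_bd _ (lexx 0).
  by rewrite (le_trans _ V1)// divr_ge0// addr_ge0.
have dVV (t : R) : 0 < t -> is_derive t 1 V (dV t).
  by move=> t0; have dEt := dE _ t0; have dZt := dZ _ t0; exact: is_deriveD.
have cV : V t @[t --> (0 : R)^'+] --> V 0.
  by apply: cvgD => //; exact: cvgZr.
(* The factor 2 inverts [(X + Y) / 2 <= V]; adding 1 keeps the constant positive when [V 0 = 0]. *)
exists (2 * V 0 + 1), (2 / 3 * ep); split.
- by rewrite ltr_wpDl// mulr_ge0.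
- by rewrite mulr_gt0// divr_gt0.
- move=> t t0; have /andP[V1 _] := V_bd _ t0.
  have := gronwall_le dVV cV dVle t0.
  set e := expR _ => Ve.
  have e0 : 0 <= e by exact: expR_ge0.
  rewrite [(X + Y) t](_ : _ = X t + Y t)//; move: V1 Ve e0; lra.
Qed.

Lemma exponential_decay_sqrt (X Y : R -> R) : (forall t, 0 <= t -> 0 <= Y t) ->
  exponential_decay (X + Y) -> exponential_decay (fun t => Num.sqrt (X t)).
Proof.
move=> Y0 [C [r [C0 r0 XY]]]; exists (Num.sqrt C), (r / 2); split.
- by rewrite sqrtr_gt0.
- by rewrite divr_gt0.
move=> t t0.
have -> : - (r / 2 * t) = - (r * t) / 2 by ring.
have -> : expR (- (r * t) / 2) = Num.sqrt (expR (- (r * t))).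
  rewrite [in RHS](_ : - (r * t) = - (r * t) / 2 + - (r * t) / 2); last by field.
  by rewrite expRD -expr2 sqrtr_sqr ger0_norm// expR_ge0.
rewrite -sqrtrM ?(ltW C0)// ler_wsqrtr//.
by rewrite (le_trans _ (XY _ t0))// lerDl Y0.
Qed.

End lyapunov.

(** * Bounds on the damping term *)

Section damping.
Context {R : realType} (m a1 a2 : R) (F : R -> R).
Context (hm : 2 <= m) (ha1 : 0 < a1) (ha2 : 0 < a2).
Context (hFs : forall z, 0 <= F z * z).
Context (hF : forall z : R, `|a1 * (z + `|z| `^ (m - 2) * z)| <= `|F z|
  <= `|a2 * (z + `|z| `^ (m - 2) * z)|).

Lemma growth_norm (c z : R) : 0 < c ->
  `|c * (z + `|z| `^ (m - 2) * z)| = c * `|z| * (1 + `|z| `^ (m - 2)).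
Proof.
move=> c0; have -> : c * (z + `|z| `^ (m - 2) * z) = c * z * (1 + `|z| `^ (m - 2)).
  by ring.
by rewrite !normrM (gtr0_norm c0) (ger0_norm (x := 1 + _))// addr_ge0 ?powR_ge0.
Qed.

Lemma damping_lower z : a1 * z ^+ 2 <= F z * z.
Proof.
have /andP[h _] := hF z; rewrite growth_norm// in h.
rewrite -(ger0_norm (hFs z)) normrM -(real_normK (num_real z)) expr2 mulrA.
rewrite ler_wpM2r// (le_trans _ h)// ler_peMr ?mulr_ge0 ?(ltW ha1)//.
by rewrite lerDl powR_ge0.
Qed.

(* Either |y| <= M |z|, and |F z| |y| is controlled by the dissipation F z * z,
   or |z| < |y| / M, and the growth bound on F applies. *)
Lemma damping_cross (Y M z y : R) : `|y| <= Y -> 1 <= M ->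
  `|F z * y| <= M * (F z * z) + a2 * (1 + Y `^ (m - 2)) / M * y ^+ 2.
Proof.
move=> yY M1; have M0 : 0 < M by rewrite (lt_le_trans ltr01).
have Y0 : 0 <= Y by rewrite (le_trans _ yY).
have k0 : 0 <= a2 * (1 + Y `^ (m - 2)) / M.
  by rewrite divr_ge0 ?(ltW M0)// mulr_ge0 ?(ltW ha2)// addr_ge0// powR_ge0.
rewrite normrM.
have [yMz|/ltW Mzy] := leP `|y| (M * `|z|).
  rewrite (le_trans (ler_wpM2l (normr_ge0 _) yMz))//.
  rewrite mulrCA -normrM (ger0_norm (hFs z)) lerDl mulr_ge0// sqr_ge0//.
have zy : `|z| <= `|y| / M by rewrite ler_pdivlMr// mulrC.
have zY : `|z| <= Y.
  rewrite (le_trans zy)// (le_trans _ yY)// ler_pdivrMr// ler_peMr//.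
rewrite -[leLHS]add0r; apply: lerD; first exact: mulr_ge0 (ltW M0) (hFs z).
have /andP[_ h] := hF z; rewrite growth_norm// in h.
rewrite -(real_normK (num_real y)) expr2.
have -> : a2 * (1 + Y `^ (m - 2)) / M * (`|y| * `|y|) =
  a2 * (`|y| / M) * (1 + Y `^ (m - 2)) * `|y| by ring.
rewrite ler_wpM2r// (le_trans h)//; apply: ler_pM.
- by rewrite mulr_ge0// ltW.
- by rewrite addr_ge0// powR_ge0.
- by rewrite ler_wpM2l// ltW.
- by rewrite lerD2l ge0_ler_powR// subr_ge0.
Qed.

Context {a b : R}.
Local Notation mu := (@lebesgue_measure R).
Implicit Types (p q w : L2 a b).

Lemma damping_lower_L2 p q : q = F \o p :> (R -> R) ->
  a1 * L2ip a b p p <= L2ip a b q p.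
Proof.
move=> qE; rewrite -L2ipZl; apply: L2ip_le; apply: aeW => x _.
rewrite qE [leLHS](_ : _ = a1 * p x * p x)// -mulrA -expr2.
exact: damping_lower.
Qed.

Lemma damping_cross_L2 p q w (Y M : R) : q = F \o p :> (R -> R) ->
  {ae mu, forall x, `]a, b[%classic x -> `|w x| <= Y} -> 1 <= M ->
  `|L2ip a b q w| <=
    M * L2ip a b q p + a2 * (1 + Y `^ (m - 2)) / M * L2ip a b w w.
Proof.
move=> qE wY M1; set k := a2 * _ / M.
have cross x : `]a, b[%classic x -> `|w x| <= Y ->
    - (M * q x * p x + k * w x * w x) <= q x * w x <= M * q x * p x + k * w x * w x.
  move=> xab wx; rewrite -ler_norml qE /=.
  by have := damping_cross (p x) wx M1; rewrite -/k expr2 !mulrA.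
rewrite -!L2ipZl ler_norml; apply/andP; split.
  rewrite lerNl -L2ipNl; apply: L2ip_leD; apply: ae_mono wY => x wY xab.
  have /andP[+ _] := cross _ xab (wY xab); rewrite lerNl; apply: le_trans.
  by rewrite [leLHS](_ : _ = - q x * w x)// mulNr.
by apply: L2ip_leD; apply: ae_mono wY => x wY xab; have /andP[] := cross _ xab (wY xab).
Qed.

End damping.

(** * Composition with a continuous function *)

Section composition.
Context {R : realType} {a b : R} (ab : a < b) (F : R -> R) (cF : continuous F).
Local Notation mu := (@lebesgue_measure R).
Implicit Types (p q v : L2 a b).

(** Composition with a superlinear function need not preserve L2; an essential bound confines the
    values of [p] to a segment, where the continuous [F] is bounded. *)
Lemma comp_L2 p (K : R) : 0 <= K ->
  {ae mu, forall x, `]a, b[%classic x -> `|p x| <= K} ->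
  exists q : L2 a b, q = F \o p :> (R -> R).
Proof.
move=> K0 pK.
have [|c _ cP] := @EVT_max R (fun x => `|F x|) (- K) K (ge0_cp K0).2.
  apply: continuous_subspaceT => x; apply: continuous_comp; first exact: cF.
  exact: norm_continuous.
apply: (bounded_L2 (K := `|F c|)).
  apply: measurableT_comp => //; exact: continuous_measurableTypeR.
by apply: ae_mono pK => x + xab => /(_ xab) h; apply: cP; rewrite in_itv/= -ler_norml.
Qed.

(** [F \o p s] is a bare function, known to be in L2 only for [s] close to the limit, hence the
    statement through pairings. Uniform convergence of [p s] and uniform continuity of [F] make the
    compositions converge uniformly. *)
Lemma comp_L2_cvg (F0 : set_system R) {FF : Filter F0} (p : R -> L2 a b)
    (p0 v : L2 a b) (K : R) (B : R -> R) : 0 <= K ->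
  {ae mu, forall x, `]a, b[%classic x -> `|p0 x| <= K} ->
  (\forall s \near F0, {ae mu, forall x, `]a, b[%classic x ->
     `|(p0 - p s) x| <= B s}) ->
  B @ F0 --> (0 : R) ->
  L2ip a b (F \o p s) v @[s --> F0] --> L2ip a b (F \o p0) v.
Proof.
move=> K0 p0K pB B0; apply/cvgrPdist_le => e e0.
pose C := Num.sqrt (b - a) * L2norm v + 1.
have C0 : 0 < C by rewrite ltr_wpDl// mulr_ge0 ?sqrtr_ge0 ?L2norm_ge0.
have eC0 : 0 < e / C by rewrite divr_gt0.
have [d d0 Hd] := segment_unif_continuous K cF eC0.
have [q0 q0E] := comp_L2 K0 p0K.
near=> s.
have pBs : {ae mu, forall x, `]a, b[%classic x -> `|(p0 - p s) x| <= B s}.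
  by near: s.
have Bs : B s <= d.
  by near: s; move/cvgr_le : B0; apply.
have psd : {ae mu, forall x, `]a, b[%classic x -> `|(p0 - p s) x| <= d}.
  by apply: ae_mono pBs => x h xab; rewrite (le_trans (h xab)).
have [q qE] : exists q : L2 a b, q = F \o p s :> (R -> R).
  apply: (@comp_L2 _ (K + d)); first by rewrite addr_ge0// ltW.
  apply: ae_mono (ae_and p0K psd) => x [h1 h2] xab.
  rewrite -[p s x](subKr (p0 x)) (le_trans (ler_normB _ _))// lerD ?h1//.
  exact: h2.
rewrite -q0E -qE -L2ipBl (le_trans (L2ip_CS _ _))//.
have : L2norm (q0 - q) <= e / C * Num.sqrt (b - a).
  apply: L2norm_le_bound => //; last exact: ltW.
  apply: ae_mono (ae_and p0K psd) => x [h1 h2] xab.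
  rewrite [(q0 - q) x](_ : _ = q0 x - q x)// q0E qE.
  by apply: Hd; [exact: h1|exact: h2].
move=> /(ler_wpM2r (L2norm_ge0 v)) /le_trans; apply.
have eE : e = e / C * C by rewrite divfK// gt_eqF.
rewrite [leRHS]eE -[X in X <= _]mulrA; apply: ler_wpM2l; first exact: ltW.
by rewrite lerDl.
Unshelve. all: by end_near. Qed.

End composition.

(** * Time derivatives of H2s-valued functions *)

Section H2s_valued.
Context {R : realType} {a b : R} (ab : a < b).
Implicit Types (u : R -> L2 a b) (w : L2 a b) (t : R).
Local Notation ge0_dnbhs t := (within [set s : R | 0 <= s] (dnbhs t)).

Lemma H2s_time_deriv_L2 u t w : 0 <= t -> (forall s, 0 <= s -> H2s (u s)) ->
  H2s w -> is_time_deriv_at H2s_norm u t w -> is_time_deriv_at L2norm u t w.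
Proof.
move=> t0 uH wH; have FF := ge0_dnbhs_proper t0.
apply: cvg0_le; near=> s.
have s0 : 0 <= s by near: s; exact: withinT.
rewrite L2norm_ge0/=; apply: (H2s_Poincare ab).
apply: (H2sB ab _ wH); apply: (H2sZ ab).
exact: (H2sB ab (uH _ s0) (uH _ t0)).
Unshelve. all: by end_near. Qed.

(** [H2s_norm] is the L2 norm of [wderiv 2], which is linear almost everywhere, so difference
    quotients are carried over isometrically. This makes the elastic energy differentiable in
    time. *)
Lemma wderiv2_time_deriv u t w : 0 <= t -> (forall s, 0 <= s -> H2s (u s)) ->
  H2s w -> is_time_deriv_at H2s_norm u t w ->
  is_time_deriv_at L2norm (fun s => wderiv 2 (u s)) t (wderiv 2 w).
Proof.
move=> t0 uH wH; have FF := ge0_dnbhs_proper t0.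
apply: cvg_trans; apply: near_eq_cvg; near=> s.
have s0 : 0 <= s by near: s; exact: withinT.
have D (z : L2 a b) : H2s z -> is_weak_deriv 2 z (wderiv 2 z).
  by move=> [_ z2]; exact: (Hk_wderivP z2).
rewrite H2s_normE; apply/L2norm_ae/wderiv_eq/is_weak_derivB; last exact: D.
by apply/is_weak_derivZ/is_weak_derivB; apply: D; exact: uH.
Unshelve. all: by end_near. Qed.

End H2s_valued.

(** * The pointwise weak equation *)

Section solution.
Context {R : realType} {a b : R} (ab : a < b).
Local Notation mu := (@lebesgue_measure R).
Implicit Types (f u du : R -> L2 a b) (v : L2 a b).

Lemma time_continuous_gt0 (N : L2 a b -> R) u (t : R) : 0 < t ->
  time_continuous_at N u t -> N (u s - u t) @[s --> t] --> (0 : R).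
Proof. by move=> t0; rewrite /time_continuous_at ge0_nbhs_gt0. Qed.

Lemma H2s_regular_L2 u du : (forall t, 0 <= t -> H2s (u t)) ->
  (forall t, 0 <= t -> H2s (du t)) ->
  (forall t, 0 <= t -> is_time_deriv_at H2s_norm u t (du t)) ->
  forall t, 0 <= t -> dt u t = du t %[ae mesU a b].
Proof.
by move=> uH duH udu t t0; apply: dt_ae => //; apply: H2s_time_deriv_L2 => //;
  [exact: duH|exact: udu].
Qed.

(** [Ck] provides witnesses [du] and [ddu], whereas the equation speaks of the chosen [dt]. As
    [dt u] and [du] agree almost everywhere at each time, [ddu] is also a time derivative of [dt u];
    the continuity statement stays with [ddu]. *)
Lemma C2_dt u : Ck setT L2norm 2 u -> exists2 ddu : R -> L2 a b,
  forall t, 0 <= t -> dt (dt u) t = ddu t %[ae mesU a b] /\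
    is_time_deriv_at L2norm (dt u) t (dt (dt u) t) &
  forall t, 0 <= t -> time_continuous_at L2norm ddu t.
Proof.
move=> [_ [du udu [_ [ddu duddu [_ cddu]]]]]; exists ddu => // t t0.
have uE s : 0 <= s -> du s = dt u s %[ae mesU a b].
  by move=> s0; apply: ae_mono (dt_ae s0 (udu _ s0)) => x h /h.
have D : is_time_deriv_at L2norm (dt u) t (ddu t).
  apply: (is_time_deriv_ae t0 uE _ (duddu _ t0)); exact: aeW.
have E := dt_ae t0 D; split=> //.
apply: (is_time_deriv_ae (u := dt u) (w := ddu t)) => //.
  by move=> s s0; exact: aeW.
by apply: ae_mono E => x h /h.
Qed.

Lemma dt_sup_bound (p v : L2 a b) : p = v %[ae mesU a b] -> H2s v ->
  {ae mu, forall x, `]a, b[%classic x ->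
    `|p x| <= Num.sqrt (b - a) * (b - a) * H2s_norm v}.
Proof.
move=> /ae_eq_mesU pv vH.
apply: ae_mono (ae_and pv (H2s_sup_bound ab vH)) => x [h1 h2] xab.
by rewrite h1//; exact: h2.
Qed.

Lemma weak_equation_pointwise (F G : R -> R) f (u0 u1 : L2 a b) u :
  continuous F -> (forall z, G z = 0) ->
  (forall t, 0 <= t -> f t = f 0 %[ae mesU a b]) ->
  pseudo_classical_solution F G f u0 u1 u -> forall v (t : R), 0 < t ->
  L2ip a b (dt (dt u) t) v
    + (L2ip a b (opL (u t)) v + L2ip a b (F \o dt u t) v - L2ip a b (f t) v) = 0.
Proof.
move=> cF G0 f0 [[[u4 cu4] [u2 [du udu [duH cdu]]] uC2] [_ _ weak]] v.
have [ddu uddu cddu] := C2_dt uC2.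
have dtE := H2s_regular_L2 u2 duH udu.
have c_ddu (t : R) : 0 < t -> {for t, continuous (fun t => L2ip a b (dt (dt u) t) v)}.
  move=> t0; have /time_continuous_gt0 := cddu _ (ltW t0); move=> /(_ t0) cd.
  have cv : L2norm (v - v) @[s --> t] --> (0 : R).
    by rewrite (L2sub_eq0 _ _).2; [exact: cvg_cst|exact: aeW].
  have := L2ip_cvg (FF := nbhs_filter t) cd cv.
  rewrite -(L2ip_ae v (uddu _ (ltW t0)).1) => cdd.
  suff : L2ip a b (dt (dt u) s) v @[s --> t] --> L2ip a b (dt (dt u) t) v by [].
  apply: cvg_near_eq cdd; near=> s.
  have s0 : 0 <= s by apply: ltW; near: s; exact: lt_nbhsr.
  exact: (L2ip_ae v (uddu _ s0).1).
have c_L (t : R) : 0 < t -> {for t, continuous (fun t => L2ip a b (opL (u t)) v)}.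
  move=> t0; have /time_continuous_gt0 := cu4 _ (ltW t0); move=> /(_ t0) cd.
  have cv : L2norm (v - v) @[s --> t] --> (0 : R).
    by rewrite (L2sub_eq0 _ _).2; [exact: cvg_cst|exact: aeW].
  apply: (L2ip_cvg _ cv); apply: cvg_near_eq cd; near=> s.
  have s0 : 0 <= s by apply: ltW; near: s; exact: lt_nbhsr.
  rewrite H4s_normE; apply/esym/L2norm_ae.
  have [us4 _ _] := u4 _ s0; have [ut4 _ _] := u4 _ (ltW t0).
  exact: (wderivB us4 ut4 (leqnn 4)).
have c_F (t : R) : 0 < t -> {for t, continuous (fun t => L2ip a b (F \o dt u t) v)}.
  move=> t0; have /time_continuous_gt0 := cdu _ (ltW t0); move=> /(_ t0) cd.
  (* The Sobolev constant of [H2s_sup_bound]: it turns continuity of [du] in H2s into uniform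
     convergence. *)
  set C := Num.sqrt (b - a) * (b - a).
  have C0 : 0 <= C by rewrite mulr_ge0 ?sqrtr_ge0// subr_ge0 ltW.
  apply: (comp_L2_cvg ab cF (K := C * H2s_norm (du t))
     (B := fun s => C * H2s_norm (du s - du t))).
  - by rewrite mulr_ge0// H2s_norm_ge0.
  - by apply: dt_sup_bound; [exact: dtE (ltW t0)|exact: duH (ltW t0)].
  - near=> s.
    have s0 : 0 <= s by apply: ltW; near: s; exact: lt_nbhsr.
    have dH := H2sB ab (duH _ s0) (duH _ (ltW t0)).
    have /ae_eq_mesU e1 := dtE _ s0; have /ae_eq_mesU e2 := dtE _ (ltW t0).
    apply: ae_mono (ae_and (ae_and e1 e2) (H2s_sup_bound ab dH)) => x [[h1 h2] h3] xab.
    rewrite [X in `|X|](_ : _ = - (du s x - du t x)); last first.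
      by rewrite opprB -h1// -h2.
    by rewrite normrN; exact: h3.
  - apply: (cvg0_le (C := C) _ cd); apply: nearW => s.
    by rewrite lexx andbT mulr_ge0// H2s_norm_ge0.
have c_f (t : R) : 0 < t -> {for t, continuous (fun t => L2ip a b (f t) v)}.
  move=> t0; rewrite /prop_for /continuous_at (L2ip_ae v (f0 _ (ltW t0))).
  apply: cvg_near_eq (cvg_cst (L2ip a b (f 0) v)); near=> s.
  have s0 : 0 <= s by apply: ltW; near: s; exact: lt_nbhsr.
  by rewrite (L2ip_ae v (f0 _ s0)).
pose h1 (t : R) := L2ip a b (dt (dt u) t) v.
pose h2 (t : R) :=
  L2ip a b (opL (u t)) v + L2ip a b (F \o dt u t) v - L2ip a b (f t) v.
have ch1 (t : R) : 0 < t -> {for t, continuous h1} by exact: c_ddu.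
have ch2 (t : R) : 0 < t -> {for t, continuous h2}.
  move=> t0; apply: cvgB; last exact: c_f.
  by apply: cvgD; [exact: c_L|exact: c_F].
apply: (eq0_of_test (h := fun t => h1 t + h2 t)).
  by move=> t t0; apply: cvgD; [exact: ch1|exact: ch2].
move=> phi tphi; have W := weak _ v tphi.
have i1 := test_mul_integrable ch1 tphi.
have i2 := test_mul_integrable ch2 tphi.
transitivity (\int[mu]_(t in `]0, +oo[) (h1 t * phi t)
              + \int[mu]_(t in `]0, +oo[) (h2 t * phi t)).
  by rewrite -RintegralD//; apply: eq_Rintegral => t _; rewrite mulrDl.
rewrite W.
rewrite addrC; apply/eqP; rewrite subr_eq0; apply/eqP.
apply: eq_Rintegral => t _; congr (_ * _).
suff G0E : L2ip a b (G \o u t) v = 0 by rewrite G0E addr0.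
rewrite /L2ip; under eq_Rintegral do rewrite /= G0 mul0r.
by rewrite Rintegral_cst// mul0r.
Unshelve. all: by end_near. Qed.

End solution.

(** * Exponential decay *)

Section decay.
Context {R : realType} {a b : R}.
Implicit Types (u : R -> L2 a b) (c w : L2 a b).

Lemma time_deriv_cvg0 u w : is_time_deriv_at L2norm u 0 w ->
  L2norm (u s - u 0) @[s --> (0 : R)^'+] --> (0 : R).
Proof.
move=> uw; apply: (time_deriv_cvg (w := w)); first exact: cvg_within.
apply: cvg_trans uw; apply: cvg_app => A h.
have {}h : \forall s \near (0 : R), s != 0 -> 0 <= s -> A s by exact: h.
have : \forall s \near (0 : R), 0 < s -> A s.
  by apply: filterS h => s + s0; apply; [rewrite gt_eqF|exact: ltW].
exact.
Qed.

Lemma time_derivBc u c t w : is_time_deriv_at L2norm u t w ->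
  is_time_deriv_at L2norm (fun s => u s - c) t w.
Proof.
rewrite /is_time_deriv_at => uw.
rewrite (_ : (fun s => _) = (fun s => L2norm ((s - t)^-1 *: (u s - u t) - w)))//.
by apply/funext => s; rewrite opprB addrA subrK.
Qed.

End decay.

Theorem corollary1p2 (R : realType) (a b : R) (hab : a < b)
    (m : R) (hm : 2 <= m) (a1 a2 : R) (ha1 : 0 < a1) (ha2 : 0 < a2)
    (ha12 : a1 <= a2)
    (f : R -> L2 a b) (hf : Ck setT L2norm 0 f)
    (hf0 : forall t : R, 0 <= t -> f t = f 0 %[ae mesU a b])
    (F : R -> R) (hFc : continuous F) (hFs : forall z, 0 <= F z * z)
    (hF : forall z : R, `|a1 * (z + `|z| `^ (m - 2) * z)| <= `|F z|
                    <= `|a2 * (z + `|z| `^ (m - 2) * z)|)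
    (G : R -> R) (hG : forall z, G z = 0)
    (u0 u1 : L2 a b) (hu0 : H4s u0) (hu1 : H2s u1)
    (u : R -> L2 a b)
    (hu : unique_pseudo_classical_solution F G f u0 u1 u)
    (uhat : L2 a b) (huhat : stationary_solution G (f 0) uhat) :
  exponential_decay (fun t => H2s_norm (u t - uhat)) /\
  exponential_decay (fun t => L2norm (dt u t)).
Proof.
have [sol _] := hu; have [uh4 uhE] := huhat; have [_ uh2 _] := uh4.
have weak := weak_equation_pointwise hab hFc hG hf0 sol.
have [[[u4 _] [u2 [du udu [duH _]]] uC2] _] := sol.
have [ddu uddu _] := C2_dt uC2.
have dtE := H2s_regular_L2 hab u2 duH udu.
have opLuh : opL uhat = f 0 %[ae mesU a b].
  by apply: ae_mono uhE => x h /h /=; rewrite hG addr0.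
pose w t := u t - uhat; pose p := dt u; pose q := dt (dt u).
(* Almost everywhere this is [wderiv 2 (w t)]; as a difference with a constant term, it has the same
   time derivative as [wderiv 2 (u t)]. *)
pose P t := wderiv 2 (u t) - wderiv 2 uhat.
have wH t : 0 <= t -> H2s (w t) by move=> t0; exact: (H2sB hab (u2 _ t0) uh2).
have PE t : 0 <= t -> wderiv 2 (w t) = P t %[ae mesU a b].
  by move=> t0; apply: (wderivB (u2 _ t0).2 uh2.2 (leqnn 2)).
have PN t : 0 <= t -> H2s_norm (w t) = L2norm (P t).
  by move=> t0; rewrite H2s_normE; apply/L2norm_ae/PE.
have dP t : 0 <= t -> is_time_deriv_at L2norm P t (wderiv 2 (du t)).
  move=> t0; apply: time_derivBc.
  exact: (wderiv2_time_deriv t0 u2 (duH _ t0) (udu _ t0)).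
have dw t : 0 <= t -> is_time_deriv_at L2norm w t (du t).
  move=> t0; apply: time_derivBc.
  exact: (H2s_time_deriv_L2 hab t0 u2 (duH _ t0) (udu _ t0)).
have dp t : 0 <= t -> is_time_deriv_at L2norm p t (q t).
  by move=> t0; have [] := uddu _ t0.
(* Elements of L2 for [F(u'(t))], with 0 as default at negative times, so that the rules for
   pairings apply to the damping term. *)
have [Fp FpE] : exists Fp : R -> L2 a b,
    forall t, 0 <= t -> Fp t = F \o p t :> (R -> R).
  have /choice[Fp FpE] : forall t, exists v : L2 a b, 0 <= t -> v = F \o p t :> (R -> R).
    move=> t; have [t0|t0] := leP 0 t; last by exists 0.
    have [|v vE] := comp_L2 hFc _ (dt_sup_bound hab (dtE _ t0) (duH _ t0)).
      by rewrite !mulr_ge0 ?sqrtr_ge0 ?H2s_norm_ge0// subr_ge0 ltW.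
    by exists v.
  by exists Fp.
have EQ (v : L2 a b) (t : R) : 0 < t -> H2s v ->
    L2ip a b (q t) v = - L2ip a b (P t) (wderiv 2 v) - L2ip a b (Fp t) v.
  move=> t0 vH; have := weak v t t0.
  rewrite -(FpE _ (ltW t0)) (L2ip_ae v (hf0 _ (ltW t0))) -(L2ip_ae v opLuh).
  rewrite (H4s_by_parts hab (u4 _ (ltW t0)) vH) (H4s_by_parts hab uh4 vH).
  have lin (x y z c : R) : x + (y + z - c) = 0 -> x = - (y - c) - z by lra.
  by rewrite L2ipBl; exact: lin.
pose X t := L2ip a b (p t) (p t); pose Y t := L2ip a b (P t) (P t).
pose Z t := L2ip a b (p t) (w t).
pose g t := L2ip a b (Fp t) (p t); pose h t := L2ip a b (Fp t) (w t).
have YN t : L2norm (P t) ^+ 2 = Y t by rewrite L2norm_sqr.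
have XN t : L2norm (p t) ^+ 2 = X t by rewrite L2norm_sqr.
have wP t : 0 <= t -> L2norm (w t) <= (b - a) ^+ 2 * L2norm (P t).
  by move=> t0; rewrite -PN//; exact: (H2s_Poincare hab (wH _ t0)).
have ba0 : 0 <= b - a by rewrite subr_ge0 ltW.
have XY0 t : [/\ 0 <= X t & 0 <= Y t] by split; exact: L2ip_ge0.
(* [B] bounds sup [|w|] as long as [|w_xx|^2] is at most the initial energy. In [K], the factor
   [(b - a) ^+ 4] is the squared constant of [|w| <= (b - a)^2 |w_xx|]. *)
pose B := Num.sqrt (b - a) * (b - a) * Num.sqrt (X 0 + Y 0).
pose K := a2 * (1 + B `^ (m - 2)) * (b - a) ^+ 4.
have decayXY : exponential_decay (X + Y).
  apply: (@lyapunov_decay R X Y Z g h a1 ((b - a) ^+ 2) K) => //.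
  - exact: sqr_ge0.
  - by rewrite !mulr_ge0 ?exprn_ge0 ?(ltW ha2)// addr_ge0// powR_ge0.
  - move=> t t0; have [X0 Y0] := XY0 t; split=> //.
    rewrite (le_trans (L2ip_CS _ _))//.
    have := ler_wpM2l (L2norm_ge0 (p t)) (wP _ t0) => /le_trans; apply.
    rewrite mulrCA ler_wpM2l ?sqr_ge0// -XN -YN.
    have := sqr_ge0 (L2norm (p t) - L2norm (P t)).
    have := mulr_ge0 (L2norm_ge0 (p t)) (L2norm_ge0 (P t)); nra.
  - by apply: L2ip_cvg; exact: time_deriv_cvg0 (dp _ (lexx 0)).
  - by apply: L2ip_cvg; exact: time_deriv_cvg0 (dP _ (lexx 0)).
  - apply: L2ip_cvg; first exact: time_deriv_cvg0 (dp _ (lexx 0)).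
    exact: time_deriv_cvg0 (dw _ (lexx 0)).
  - move=> t t0; have t0' := ltW t0.
    have D1 := is_derive_L2ip t0 (dp _ t0') (dp _ t0').
    have D2 := is_derive_L2ip t0 (dP _ t0') (dP _ t0').
    apply: is_derive_eq (is_deriveD D1 D2) _.
    (* [EQ] is applied to [du t], which lies in H2s and equals [p t] almost everywhere. The pairings
       of [P t] with [wderiv 2 (du t)] then cancel and only the dissipation remains. *)
    rewrite (L2ipC (p t) (q t)) (L2ip_aer (q t) (dtE _ t0')) (EQ _ _ t0 (duH _ t0')).
    rewrite (L2ipC (wderiv 2 (du t))) /g (L2ip_aer (Fp t) (dtE _ t0')).
    by move: (L2ip a b (P t) _) (L2ip a b (Fp t) _) => x y; ring.
  - move=> t t0; have t0' := ltW t0.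
    apply: is_derive_eq (is_derive_L2ip t0 (dp _ t0') (dw _ t0')) _.
    rewrite (EQ _ _ t0 (wH _ t0')) (L2ip_aer (P t) (PE _ t0')).
    rewrite -(L2ip_aer (p t) (dtE _ t0')) /X /Y /h -/(p t).
    by move: (L2ip a b (p t) _) (L2ip a b (P t) _) (L2ip a b (Fp t) _) => x y z; ring.
  - by move=> t t0; apply: (damping_lower_L2 ha1 hFs hF); exact: FpE (ltW t0).
  - move=> M t M1 t0 YE; have t0' := ltW t0.
    have wB : {ae lebesgue_measure, forall x, `]a, b[%classic x -> `|w t x| <= B}.
      apply: ae_mono (H2s_sup_bound hab (wH _ t0')) => x hx xab.
      rewrite (le_trans (hx xab))// ler_wpM2l ?mulr_ge0 ?sqrtr_ge0//.
      by rewrite PN// L2normE ler_wsqrtr.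
    apply: le_trans (damping_cross_L2 hm ha2 hFs hF (FpE _ t0') wB M1) _.
    rewrite lerD2l.
    have -> : K / M * Y t = a2 * (1 + B `^ (m - 2)) / M * ((b - a) ^+ 4 * Y t).
      by rewrite /K; ring.
    apply: ler_wpM2l.
      rewrite divr_ge0 ?mulr_ge0 ?addr_ge0 ?powR_ge0 ?(ltW ha2)//.
      by rewrite (le_trans ler01).
    rewrite -L2norm_sqr -YN (_ : (b - a) ^+ 4 = ((b - a) ^+ 2) ^+ 2); last by ring.
    by rewrite -exprMn ler_pXn2r ?nnegrE ?mulr_ge0 ?sqr_ge0 ?L2norm_ge0// wP.
split.
  have YX : exponential_decay (Y + X) by rewrite addrC.
  have [C [r [C0 r0 H]]] := exponential_decay_sqrt (fun t _ => (XY0 t).1) YX.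
  exists C, r; split=> // t t0; rewrite -/(w t) PN// L2normE; exact: H.
have [C [r [C0 r0 H]]] := exponential_decay_sqrt (fun t _ => (XY0 t).2) decayXY.
by exists C, r; split=> // t t0; rewrite L2normE; exact: H.
Qed.
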